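(* Let $M$ be a non-compact $C^r$ manifold and $\mathcal F$ a codimension one $C^r$ foliation on $M$ such that all leaves $F$ are compact and satisfy $\mathrm{Hol}(F)=1$. Then there is a $C^r$ function $f:M\to\mathbb R$ satisfying $\mathcal F=\mathcal F(df)$ and $df(x)\neq0$ for all $x\in M$.
   Context: Here $r\ge1$ is an integer, and manifolds are real and second countable. $\mathrm{Hol}(F)$ is the holonomy group of the leaf $F$, i.e. the image of the holonomy representation of $\pi_1(F,p)$ in the group of germs at $p$ of automorphisms, fixing $p$, of a local transversal through $p\in F$ (it does not depend on the base point $p$). $\mathcal F(df)$ denotes the codimension one foliation induced by the one-form $df$; thus $\mathcal F=\mathcal F(df)$ means that $T_pF=\ker df(p)$ for every leaf $F$ of $\mathcal F$ and every $p\in F$.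
   Formalization: M is assumed connected (and Hausdorff); without connectedness the claim fails, e.g. for the disjoint union of R and a circle, foliated by points. *)

(* Defs.v *)
From HB Require Import structures.
From mathcomp Require Import all_boot all_order all_algebra.
From mathcomp Require Import all_classical all_reals all_analysis.
From Stdlib Require Import Relation_Operators.

Set Implicit Arguments.
Unset Strict Implicit.
Unset Printing Implicit Defensive.

Import Order.TTheory GRing.Theory Num.Theory.
Import numFieldNormedType.Exports.

Local Open Scope classical_set_scope.
Local Open Scope ring_scope.

(** * Functions of class C^k *)

(* [U] is meant to be an open subset of a finite-dimensional [V]; only the
   values of [f] on [U] matter.  Since [V] is finite-dimensional, the derivative
   of [f] is C^k iff all the directional derivatives of [f] are. *)
Fixpoint Ck (R : realType) (V W : normedModType R) (k : nat) (U : set V)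
    (f : V -> W) : Prop :=
  if k is k'.+1 then
    (forall x, U x -> differentiable f x) /\ forall v, Ck k' U ('D_v f)
  else forall x, U x -> {for x, continuous f}.

(** * C^r manifolds *)

(* A homeomorphism [cmap] from an open set [cdom] onto an open subset of R^n,
   with inverse [cinv].  Both maps are total; their values outside [cdom] and
   [cimg] are irrelevant. *)
Record chart (R : realType) (n : nat) (M : topologicalType) := Chart {
  cdom : set M;
  cmap : M -> 'rV[R]_n;
  cinv : 'rV[R]_n -> M;
  cdom_open : open cdom;
  cimg_open : open (cmap @` cdom);
  cmapK : forall p, cdom p -> cinv (cmap p) = p;
  cmap_continuous : {within cdom, continuous cmap};
  cinv_continuous : {within cmap @` cdom, continuous cinv}
}.

Section Manifold.
Context {R : realType} {n : nat} {M : topologicalType}.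
Implicit Types (phi psi : chart R n M) (A : set (chart R n M)).

Definition cimg phi : set 'rV[R]_n := cmap phi @` cdom phi.

Definition Cr_compatible (r : nat) phi psi : Prop :=
  Ck r (cmap phi @` (cdom phi `&` cdom psi)) (cmap psi \o cinv phi) /\
  Ck r (cmap psi @` (cdom phi `&` cdom psi)) (cmap phi \o cinv psi).

Definition covers A : Prop := \bigcup_(phi in A) cdom phi = [set: M].

Definition Cr_atlas (r : nat) A : Prop :=
  covers A /\ forall phi psi, A phi -> A psi -> Cr_compatible r phi psi.

Definition Cr_function (r : nat) A (f : M -> R) : Prop :=
  forall phi, A phi -> Ck r (cimg phi) (f \o cinv phi : 'rV[R]_n -> R^o).

(* df(p), where T_pM is identified with R^n by means of the chart [phi] at p *)
Definition differential (f : M -> R) phi (p : M) : 'rV[R]_n -> R :=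
  'd (f \o cinv phi : 'rV[R]_n -> R^o) (cmap phi p).

End Manifold.

(** * Codimension one foliations *)

Section Foliation.
Context {R : realType} {m : nat} {M : topologicalType}.
Implicit Types (phi psi : chart R m.+1 M) (A F : set (chart R m.+1 M)).

(* the last coordinate; the first m coordinates run along the plaques *)
Definition tcoord phi (p : M) : R := cmap phi p ord0 ord_max.

Definition open_rectangle (B : set 'rV[R]_m.+1) : Prop :=
  exists J : 'I_m.+1 -> set R,
    (forall i, open (J i) /\ is_interval (J i)) /\
    B = [set x | forall i, J i (x ord0 i)].

(* h is near p the transverse part of the change of foliated charts, which has
   the form (x, y) |-> (h1 (x, y), h y) *)
Definition transverse_change phi psi (p : M) (h : R -> R) : Prop :=
  \forall q \near p, tcoord psi q = h (tcoord phi q).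

(* F is a foliated atlas for the C^r manifold with atlas A; its charts belong to
   the C^r structure defined by A *)
Definition Cr_foliation (r : nat) A F : Prop :=
  [/\ covers F,
      forall phi, F phi -> open_rectangle (cimg phi),
      forall phi psi, F phi -> A psi -> Cr_compatible r phi psi &
      forall phi psi p, F phi -> F psi -> cdom phi p -> cdom psi p ->
        exists h, transverse_change phi psi p h].

Definition same_plaque F (p q : M) : Prop :=
  exists2 phi, F phi & [/\ cdom phi p, cdom phi q & tcoord phi p = tcoord phi q].

(* leaves are the classes of the equivalence relation generated by plaques *)
Definition leaf F (p : M) : set M :=
  [set q | clos_refl_trans M (same_plaque F) p q].

Definition is_leaf F (L : set M) : Prop := exists p, L = leaf F p.

(* V is open for the leaf topology iff it meets every plaque in a relatively
   open subset of this plaque *)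
Definition leaf_open F (V : set M) : Prop :=
  forall phi p, F phi -> cdom phi p -> V p ->
    \forall q \near p, cdom phi q -> tcoord phi q = tcoord phi p -> V q.

Lemma leaf_openT F : leaf_open F setT.
Proof. by move=> phi p _ _ _; apply: nearW. Qed.

Lemma leaf_openI F : setI_closed (leaf_open F).
Proof.
move=> V W oV oW phi p Fphi dp [Vp Wp].
have := oV _ _ Fphi dp Vp; have := oW _ _ Fphi dp Wp.
by apply: filterS2 => q Wq Vq dq eq; split; [exact: Vq | exact: Wq].
Qed.

Lemma leaf_open_bigU F (I : Type) (V : I -> set M) :
  (forall i, leaf_open F (V i)) -> leaf_open F (\bigcup_i V i).
Proof.
move=> oV phi p Fphi dp [i _ Vip].
have := oV i _ _ Fphi dp Vip.
by apply: filterS => q Vq dq eq; exists i => //; exact: Vq.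
Qed.

(* M with the leaf topology *)
Definition leaf_space F : Type := M.

HB.instance Definition _ F := Choice.on (leaf_space F).
HB.instance Definition _ F := isOpenTopological.Build (leaf_space F)
  (@leaf_openT F) (@leaf_openI F) (@leaf_open_bigU F).

(* T_pF in the chart psi at p: the vectors whose last coordinate vanishes when
   they are expressed in a foliated chart at p *)
Definition leaf_tangent F psi (p : M) : set 'rV[R]_m.+1 :=
  [set v | exists2 phi, F phi /\ cdom phi p &
     ('d (cmap phi \o cinv psi) (cmap psi p) v : 'rV[R]_m.+1) ord0 ord_max = 0].

(* the foliation is F(df) *)
Definition foliation_induced_by A F (f : M -> R) : Prop :=
  forall L p psi, is_leaf F L -> L p -> A psi -> cdom psi p ->
    leaf_tangent F psi p = [set v | differential f psi p v = 0].

(** ** Holonomy *)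

(* A foliated chart phi at p provides the local transversal through p on which
   the first m coordinates are those of p.  It is parametrized by [tcoord phi],
   so that maps between transversals are written as functions R -> R.

   [transport F c phi t psi h]: along the path c, starting at time 0 from the
   transversal given by phi, a chain of plaques leads at time t to the
   transversal given by psi, and h represents the resulting germ at
   [tcoord phi (c 0)]. *)
Inductive transport F (c : R -> M) phi : R -> chart R m.+1 M -> (R -> R) -> Prop :=
| transport_start : F phi -> cdom phi (c 0) -> transport F c phi 0 phi id
| transport_plaque t t' psi h :
    transport F c phi t psi h -> t <= t' ->
    (forall s, t <= s <= t' -> cdom psi (c s)) ->
    transport F c phi t' psi h
| transport_change t psi psi' h g :
    transport F c phi t psi h -> F psi' -> cdom psi' (c t) ->
    transverse_change psi psi' (c t) g ->
    transport F c phi t psi' (g \o h).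

Definition leaf_loop F (p : M) (c : R -> M) : Prop :=
  [/\ {within `[0, 1], continuous (c : R -> leaf_space F)}, c 0 = p & c 1 = p].

Definition germ (y : R) (h : R -> R) : set (R -> R) :=
  [set g | \forall z \near y, g z = h z].

(* the image of the holonomy representation of pi_1(F, p) *)
Definition holonomy_group F phi (p : M) : set (set (R -> R)) :=
  [set germ (tcoord phi p) h | h in
     [set h | exists2 c, leaf_loop F p c & transport F c phi 1 phi h]].

Definition trivial_holonomy F (L : set M) : Prop :=
  forall p phi, L p -> F phi -> cdom phi p ->
    holonomy_group F phi p = [set germ (tcoord phi p) id].

End Foliation.

(* Main.v *)
(* Trivial holonomy makes the transport of the transversal coordinate to a
   fixed foliated chart independent of the path, so near a compact leaf it
   defines a C^r first integral; by compactness of the leaf, this first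
   integral identifies the leaves of a saturated neighbourhood with an
   interval (Reeb stability). The leaf space is thus a Hausdorff, second
   countable, connected C^r manifold of dimension one, and it is not compact
   because M is not. A locally finite sum of bump functions times |dg|, over
   countably many such first integrals g, is a positive density of class
   C^(r-1) on the leaf space. Integrating it gives C^r local coordinates
   whose changes have the form y |-> +-y + c. A unit speed curve in these
   coordinates, extended as far as possible, is onto by connectedness and
   injective since M is not compact; its inverse is the function f. *)

Require Import Defs.
From mathcomp Require Import all_boot all_order all_algebra.
From mathcomp Require Import all_classical all_reals all_analysis.
From mathcomp Require Import ring lra.
From Stdlib Require Import Relation_Operators.

Set Implicit Arguments.
Unset Strict Implicit.
Unset Printing Implicit Defensive.

Import Order.TTheory GRing.Theory Num.Theory.
Import numFieldNormedType.Exports.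

Local Open Scope classical_set_scope.
Local Open Scope ring_scope.

(** * Functions of class C^k *)

(** The leaf space is never formed as a quotient: its points are represented by points of [M] up to
    [leaf F], its neighbourhoods appear as saturated predicates on [M], and a curve in it is a map
    [R -> M] of which only the leaves matter. With r = k + 1, differentiating a change of transverse
    coordinates costs one class, so the density is only of class C^k, and taking a primitive gives
    C^(k+1) back. Cut-offs of class C^k are therefore enough, and powers of max(0, x) provide them.
    Only positivity of the density is wanted, so the weights need not sum to 1. *)

Section DifferentiableNear.
Context {R : realType} {V W : normedModType R}.

Lemma near_eq_diff (f g : V -> W) (x : V) :
  {near x, f =1 g} -> differentiable f x ->
  differentiable g x /\ 'd g x = 'd f x :> (V -> W).
Proof.
move=> fg df.
have /diff_locallyP[cf ef] := df.
have eg : g \o shift x = cst (g x) + 'd f x +o_ 0 id.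
  apply/eqaddoP => e e0.
  have /eqaddoP/(_ e e0) := ef.
  have fg0 : \forall h \near (0 : V), f (h + x) = g (h + x).
    have /(nbhs_singleton) _ := fg.
    have : (fun h => h + x) @ (0 : V) --> x.
      rewrite -[X in _ --> X]add0r; apply: cvgD; [exact: cvg_id|exact: cvg_cst].
    by move=> /(_ _ fg).
  apply: filterS2 fg0 => h /= fgh.
  by rewrite !fctE fgh (nbhs_singleton fg).
have dg : 'd g x = 'd f x :> (V ->
  W) by exact: (@diff_unique _ _ _ g ('d f x) x cf eg).
split; last exact: dg.
by apply/diff_locallyP; split; rewrite dg.
Qed.

End DifferentiableNear.

Section CkTheory.
Context {R : realType} {V : normedModType R}.
Implicit Types (W : normedModType R) (U : set V) (k : nat).

Lemma Ck_sub W k U U' (f : V -> W) : U' `<=` U -> Ck k U f -> Ck k U' f.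
Proof.
move=> sU; elim: k f => [|k IH] f /=; first by move=> cf x /sU/cf.
by move=> [df dvf]; split=> [x /sU/df//|v]; exact: IH.
Qed.

(** Openness of [U] turns pointwise equality into equality of germs, which is what derivatives
    see. *)
Lemma Ck_eq W k U (f g : V -> W) : open U -> (forall x, U x -> f x = g x) ->
  Ck k U f -> Ck k U g.
Proof.
move=> oU; have nfg h1 h2 : (forall x, U x -> h1 x = h2 x :> W) ->
    forall x, U x -> {near x, h1 =1 h2}.
  move=> h x Ux; near=> y; apply: h; near: y; exact: open_nbhs_nbhs.
elim: k f g => [|k IH] f g fg /=.
  move=> cf x Ux; rewrite /prop_for /continuous_at -fg //.
  by apply: (cvg_trans _ (cf _ Ux)); apply: near_eq_cvg; exact: nfg.
move=> [df dvf]; split=> [x Ux|v].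
  by have [] := near_eq_diff (nfg _ _ fg _ Ux) (df _ Ux).
apply: IH (dvf v) => x Ux; apply: near_eq_derive; exact: nfg fg _ Ux.
Unshelve. all: by end_near. Qed.

Lemma Ck_le W k j U (f : V -> W) : (j <= k)%N -> Ck k U f -> Ck j U f.
Proof.
elim: k j f => [|k IH] [|j] f //= => [_ [df _] x Ux|jk [df dvf]].
  exact/differentiable_continuous/df.
by split=> // v; apply: IH.
Qed.

Lemma Ck_cst W k U (c : W) : Ck k U (cst c).
Proof.
elim: k c => [|k IH] c /=; first by move=> x _; exact: cst_continuous.
split=> [x _|v]; first exact: differentiable_cst.
rewrite (_ : 'D_v _ = cst 0) //; apply/funext => x; exact: derive_cst.
Qed.

Lemma Ck_add W k U (f g : V -> W) : open U ->
  Ck k U f -> Ck k U g -> Ck k U (f + g).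
Proof.
move=> oU; elim: k f g => [|k IH] f g /=.
  by move=> cf cg x Ux; apply: continuousD; [exact: cf|exact: cg].
move=> [df dvf] [dg dvg]; split=> [x Ux|v].
  by apply: differentiableD; [exact: df|exact: dg].
apply: (Ck_eq oU _ (IH _ _ (dvf v) (dvg v))) => x Ux /=.
by rewrite deriveD //; apply: diff_derivable; [exact: df|exact: dg].
Qed.

(** Leibniz rule: each product pairs a derivative with an undifferentiated factor, which is first
    weakened from C^(k+1) to C^k to meet the induction hypothesis. *)
Lemma Ck_mul k U (f g : V -> R^o) : open U ->
  Ck k U f -> Ck k U g -> Ck k U (f * g : V -> R^o).
Proof.
move=> oU; elim: k f g => [|k IH] f g /=.
  by move=> cf cg x Ux; apply: continuousM; [exact: cf|exact: cg].
move=> cf cg; have [df dvf] := cf; have [dg dvg] := cg.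
split=> [x Ux|v]; first by apply: differentiableM; [exact: df|exact: dg].
apply: (Ck_eq oU _ (Ck_add oU (IH _ _ (Ck_le (leqnSn k) cf) (dvg v))
  (IH _ _ (Ck_le (leqnSn k) cg) (dvf v)))) => x Ux /=.
by rewrite deriveM //; apply: diff_derivable; [exact: df|exact: dg].
Qed.

Lemma Ck_sum k U n (f : 'I_n -> V -> R^o) : open U ->
  (forall i, Ck k U (f i)) -> Ck k U ((fun x => \sum_i f i x) : V -> R^o).
Proof.
move=> oU; elim: n f => [|n IH] f cf.
  by apply: (Ck_eq oU _ (Ck_cst k U 0)) => x _; rewrite big_ord0.
apply: (Ck_eq oU _ (Ck_add oU (IH _ (fun i => cf (widen_ord (leqnSn n) i)))
  (cf ord_max))) => x Ux.
by rewrite big_ord_recr.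
Qed.

Lemma Ck_comp_real k U (f : V -> R^o) (U' : set R^o) (h : R^o -> R^o) :
  open U -> (forall x, U x -> U' (f x)) ->
  Ck k U f -> Ck k U' h -> Ck k U (h \o f).
Proof.
move=> oU UU'; elim: k f h UU' => [|k IH] f h UU' /=.
  move=> cf ch x Ux; apply: continuous_comp; [exact: cf|exact/ch/UU'].
move=> cf [dh dvh]; have [df dvf] := cf.
have dhf x : U x -> differentiable (h \o f) x.
  by move=> Ux; apply: differentiable_comp; [exact: df|exact/dh/UU'].
split=> // v; apply: (Ck_eq oU _ (Ck_mul oU
   (IH _ _ UU' (Ck_le (leqnSn k) cf) (dvh 1)) (dvf v))) => x Ux /=.
have dhx := dh _ (UU' _ Ux).
rewrite (deriveE _ (dhf _ Ux)) (diff_comp (df _ Ux) dhx) fctE /=.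
rewrite (deriveE _ (df _ Ux)) (deriveE _ dhx).
rewrite -[X in _ = 'd h (f x) X]mulr1 linearZ /= [RHS]mulrC //.
Qed.

Lemma Ck_coord k U n (f : V -> 'rV[R]_n) (i : 'I_n) : open U ->
  Ck k U f -> Ck k U ((fun x => f x ord0 i) : V -> R^o).
Proof.
move=> oU; elim: k f => [|k IH] f /=.
  move=> cf x Ux; exact: (continuous_comp (cf x Ux) (@coord_continuous _ _ _ _ _
    (f x))).
move=> [df dvf]; split=> [x Ux|v].
  have -> : (fun x => f x ord0 i) = (fun N : 'rV[R]_n => N ord0 i) \o f by [].
  by apply: differentiable_comp; [exact: df|exact: differentiable_coord].
apply: (Ck_eq oU _ (IH _ (dvf v))) => x Ux /=.
by rewrite derive_mx ?mxE //; apply: diff_derivable; exact: df.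
Qed.

(** The direction ['D_v f x] in which [h] gets differentiated varies with [x], whereas [Ck] speaks
    of fixed directions. Expanding it in the standard basis gives a sum of products of functions of
    class C^k. *)
Lemma Ck_comp_rV k n U (f : V -> 'rV[R]_n) (U' : set 'rV[R]_n)
    (h : 'rV[R]_n -> R^o) : open U -> (forall x, U x -> U' (f x)) ->
  Ck k U f -> Ck k U' h -> Ck k U (h \o f).
Proof.
move=> oU UU'; elim: k f h UU' => [|k IH] f h UU' /=.
  move=> cf ch x Ux; apply: continuous_comp; [exact: cf|exact/ch/UU'].
move=> cf [dh dvh]; have [df dvf] := cf.
have dhf x : U x -> differentiable (h \o f) x.
  by move=> Ux; apply: differentiable_comp; [exact: df|exact/dh/UU'].
split=> // v; pose e i := delta_mx ord0 i : 'rV[R]_n.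
apply: (Ck_eq oU _ (@Ck_sum k U n
   (fun i => (('D_(e i) h \o f) * (fun x => 'D_v f x ord0 i))) oU _));
     last first.
  move=> i; apply: (Ck_mul oU); last by apply: Ck_coord.
  by apply: IH => //; exact: Ck_le (leqnSn k) cf.
move=> x Ux /=.
have dhx := dh _ (UU' _ Ux).
rewrite (deriveE _ (dhf _ Ux)) (diff_comp (df _ Ux) dhx) /= -(deriveE _ (df _
  Ux)).
rewrite [X in _ = 'd h (f x) X]row_sum_delta linear_sum /=.
apply: eq_bigr => i _; rewrite linearZ /= fctE /= (deriveE _ dhx).
by rewrite [RHS]mulrC.
Qed.

End CkTheory.

Lemma Ck_local {R : realType} {V W : normedModType R} k (U : set V)
    (f : V -> W) :
  (forall x, U x -> exists U', [/\ open U', U' x & Ck k U' f]) -> Ck k U f.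
Proof.
elim: k f => [|k IH] f lf /=.
  by move=> x /lf[U' [_ U'x cf]]; exact: cf.
split=> [x /lf[W1 [_ W1x [df _]]]|v]; first by apply: df.
by apply: IH => x /lf[U' [oU' U'x [_ dvf]]]; exists U'; split=> //; exact: dvf.
Qed.

(** A line has constant velocity [e], so the derivative of the composite along [v] is the
    directional derivative of [f] along [v *: e], again restricted to the line. *)
Lemma Ck_comp_line {R : realType} {V W : normedModType R} k (U : set R^o)
    (U' : set V) (b e : V) (f : V -> W) : open U ->
  (forall t, U t -> U' (b + t *: e)) -> Ck k U' f ->
  Ck k U ((fun t => f (b + t *: e)) : R^o -> W).
Proof.
move=> oU UU'; have dl (t : R^o) :
    is_diff t ((fun t => b + t *: e) : R^o -> V) ((fun t => t *: e) : R^o -> V).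
  have d1 : is_diff t (cst b : R^o -> V) 0 by exact: is_diff_cst.
  have d2 : is_diff t ((fun t => t *: e) : R^o -> V) (fun t => t *: e).
    exact: is_diff_scalel.
  have -> : ((fun t => b + t *: e) : R^o -> V) = cst b + (fun t =>
    t *: e) by [].
  by apply: is_diff_eq (is_diffD d1 d2) _; rewrite add0r.
elim: k f => [|k IH] f /=.
  move=> cf t Ut; apply: continuous_comp; last exact/cf/UU'.
  by apply: differentiable_continuous; case: (dl t).
move=> [df dvf].
have dfl t : U t -> differentiable (f \o (fun t : R^o => b + t *: e)) t.
  move=> Ut; apply: differentiable_comp; first by case: (dl t).
  exact/df/UU'.
split=> // v; apply: (Ck_eq oU _ (IH _ (dvf (v *: e)))) => t Ut /=.
have dft := df _ (UU' _ Ut).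
have [dlt dlE] := dl t.
by rewrite (deriveE _ dft) (deriveE _ (dfl _ Ut)) (diff_comp dlt dft) /= dlE.
Qed.

Section RealCk.
Context {R : realType}.
Implicit Types (h u : R^o -> R^o) (U : set R^o) (k : nat).

Lemma real_deriveE h (x v : R^o) : derivable h x 1 -> 'D_v h x = v * 'D_1 h x.
Proof.
move=> /derivable1_diffP dh; rewrite !deriveE //.
by rewrite -[X in 'd h x X]mulr1 [LHS]linearZ.
Qed.

(** This regains the class lost by differentiating: in dimension one every directional derivative of
    [F] is a constant multiple of [h]. *)
Lemma Ck_primitive k U (F : R^o -> R^o) h : open U ->
  (forall x, U x -> is_derive x 1 F (h x)) -> Ck k U h -> Ck k.+1 U F.
Proof.
move=> oU dF ch; split=> [x Ux|v].
  by apply/derivable1_diffP; case: (dF x Ux).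
apply: (Ck_eq oU _ (Ck_mul oU (Ck_cst k U v) ch)) => x Ux.
by have [dFx Fx] := dF x Ux; rewrite real_deriveE // Fx.
Qed.

Lemma Ck_derive1 k U h : Ck k.+1 U h -> Ck k U (h^`())%classic.
Proof.
move=> [_ dh]; have -> : (h^`())%classic = 'D_1 h; last exact: dh.
by apply/funext => x; rewrite derive1E.
Qed.

Lemma Ck_id k U : Ck k U (id : R^o -> R^o).
Proof.
case: k => [|k] /=; first by move=> x _; exact: cvg_id.
split=> [x _|v]; first by case: (is_diff_id x).
have -> : 'D_v id = cst v by apply/funext => x; rewrite derive_id.
exact: Ck_cst.
Qed.

Lemma Ck_opp k U h : open U -> Ck k U h -> Ck k U (- h : R^o -> R^o).
Proof.
move=> oU ch; apply: (Ck_eq oU _ (Ck_mul oU (Ck_cst k U (-1 : R^o)) ch)) => x _.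
by rewrite fctE /= mulN1r.
Qed.

Lemma Ck_norm k : Ck k [set x : R^o | x != 0] (fun x : R^o => `|x|).
Proof.
have og : open [set y : R^o | 0 < y] by exact: (@open_gt R 0).
have ol : open [set y : R^o | y < 0] by exact: (@open_lt R 0).
apply: Ck_local => x /= x0; case: (ltrgt0P x) => [xp|xn|x00].
- exists [set y | 0 < y]; split => //.
  by apply: (Ck_eq og _ (Ck_id k _)) => y /= y0; rewrite gtr0_norm.
- exists [set y | y < 0]; split => //.
  apply: (Ck_eq ol _ (Ck_opp ol (Ck_id k _))) => y /= y0.
  by rewrite ltr0_norm.
- by rewrite x00 eqxx in x0.
Qed.

(** A function of class C^n that vanishes for x <= 0 and is positive for x > 0; all cut-offs below
    are made from it. *)
Definition pospow (n : nat) (x : R^o) : R^o := Num.max 0 x ^+ n.+1.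

Lemma pospow_ge0 n x : 0 <= pospow n x.
Proof. by rewrite exprn_ge0 // le_max lexx. Qed.

Lemma pospow_gt0 n x : (0 < pospow n x) = (0 < x).
Proof.
rewrite /pospow; case: (ltP 0 x) => x0; last by rewrite exprS mul0r ltxx.
by apply: exprn_gt0.
Qed.

Lemma pospow_le0 n x : x <= 0 -> pospow n x = 0.
Proof. by move=> x0; rewrite /pospow max_l // expr0n. Qed.

Lemma continuous_pospow n : continuous (pospow n).
Proof.
move=> x; have c : {for x, continuous ((cst 0 : R^o -> R^o) \max id)}.
  by apply: continuous_max; [exact: cvg_cst|exact: cvg_id].
exact: (continuous_comp c (@exprn_continuous R n.+1 _)).
Qed.

Lemma is_derive_pospow n (x : R^o) :
  is_derive x 1 (pospow n.+1) (n.+2%:R * pospow n x).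
Proof.
case: (ltrgt0P x) => [xp|xn|->].
- have e : \forall y \near x, (y : R^o) ^+ n.+2 = pospow n.+1 y.
    near=> y; rewrite /pospow max_r //; near: y; exact: (lt_le_nbhsr xp).
  apply: (near_eq_is_derive e); rewrite /pospow max_r ?ltW //.
  apply: DeriveDef; first by apply: exprn_derivable.
  by rewrite exp_derive [_%:A]mulr1 -mulr_natl.
- have e : \forall y \near x, (cst 0 : R^o -> R^o) y = pospow n.+1 y.
    near=> y; rewrite pospow_le0 //; near: y; exact: (lt_le_nbhsl xn).
  apply: (near_eq_is_derive e); rewrite pospow_le0 ?mulr0 ?ltW //;
    exact: is_derive_cst.
- rewrite pospow_le0 ?lexx // mulr0.
  (* At the corner the difference quotient is [pospow n] itself, which is continuous and vanishes at
     0. *)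
  have cv : (fun h : R => h^-1 *: ((pospow n.+1 \o shift (0 : R^o)) (h *: 1) -
       pospow n.+1 0)) @ 0^' --> (0 : R^o).
    apply: (@cvg_trans _ (pospow n @ (0 : R^o)^')); last first.
      have /continuous_withinNx := @continuous_pospow n 0.
      by rewrite pospow_le0.
    apply: near_eq_cvg; near=> h.
    have h0 : h != 0 by near: h; exact: nbhs_dnbhs_neq.
    rewrite /= addr0 [h *: 1]mulr1 (pospow_le0 n.+1 (lexx 0)) subr0.
    have -> : pospow n.+1 h = h * pospow n h.
      rewrite /pospow; case: (leP 0 h) => [_|_]; first by rewrite exprS.
      by rewrite !expr0n mulr0.
    by rewrite scalerA mulVf // scale1r.
  by apply: DeriveDef; [apply/cvg_ex; exists 0|exact: cvg_lim].
Unshelve. all: by end_near. Qed.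

Lemma Ck_pospow n : Ck n setT (pospow n).
Proof.
elim: n => [|n IH]; first by move=> x _; exact: continuous_pospow.
apply: (@Ck_primitive n setT (pospow n.+1) (cst n.+2%:R * pospow n)).
- exact: openT.
- by move=> x _; exact: is_derive_pospow.
- by apply: Ck_mul => //; [exact: openT|exact: Ck_cst].
Qed.

End RealCk.

(** * Germs of functions of one variable *)

Local Notation deriv F x d :=
  (is_derive (x : _^o) (1 : _^o) (F : _^o -> _^o) (d : _^o)).

Section SmoothAt.
Context {R : realType}.
Implicit Types (h u : R -> R) (y : R) (k : nat).

Definition smooth_at k h y : Prop :=
  exists U : set R^o, [/\ open U, U y & Ck k U (h : R^o -> R^o)].

Lemma smooth_at_near k h y : smooth_at k h y ->
  \forall z \near y, smooth_at k h z.
Proof.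
move=> [U [oU Uy ch]]; near=> z; exists U; split=> //.
by near: z; exact: (open_nbhs_nbhs (conj oU Uy)).
Unshelve. all: by end_near. Qed.

Lemma smooth_at_eq k h u y : (\forall z \near y, h z = u z) ->
  smooth_at k h y -> smooth_at k u y.
Proof.
move=> hu [U [oU Uy ch]].
exists (U `&` [set z | h z = u z]°); split.
- by apply: openI => //; exact: open_interior.
- by split.
- apply: (@Ck_eq _ _ _ _ _ h).
  + by apply: openI => //; exact: open_interior.
  + by move=> x [_ /interior_subset].
  + by apply: Ck_sub ch => x [].
Qed.

Lemma smooth_at_ext k h u y : h =1 u -> smooth_at k h y -> smooth_at k u y.
Proof. by move=> /funext ->. Qed.

Lemma smooth_at_le k j h y : (j <= k)%N -> smooth_at k h y -> smooth_at j h y.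
Proof. by move=> jk [U [oU Uy ch]]; exists U; split=> //; exact: Ck_le ch. Qed.

Lemma smooth_at_cst k c y : smooth_at k (fun=> c) y.
Proof. by exists setT; split=> //; [exact: openT|exact: Ck_cst]. Qed.

Lemma smooth_at_id k y : smooth_at k id y.
Proof. by exists setT; split=> //; [exact: openT|exact: Ck_id]. Qed.

Lemma smooth_at_op2 (op : R -> R -> R) k h u y :
  (forall U (f g : R^o -> R^o), open U -> Ck k U f -> Ck k U g ->
     Ck k U ((fun x => op (f x) (g x)) : R^o -> R^o)) ->
  smooth_at k h y -> smooth_at k u y -> smooth_at k (fun x => op (h x) (u x)) y.
Proof.
move=> cop [U [oU Uy ch]] [U' [oU' U'y cu]]; exists (U `&` U').
have oUU := openI oU oU'; split=> //; apply: cop => //.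
  by apply: Ck_sub ch => x [].
by apply: Ck_sub cu => x [].
Qed.

Lemma smooth_at_add k h u y : smooth_at k h y -> smooth_at k u y ->
  smooth_at k (fun x => h x + u x) y.
Proof. by apply: (@smooth_at_op2 +%R) => U f g oU; exact: Ck_add. Qed.

Lemma smooth_at_mul k h u y : smooth_at k h y -> smooth_at k u y ->
  smooth_at k (fun x => h x * u x) y.
Proof. by apply: (@smooth_at_op2 *%R) => U f g oU; exact: Ck_mul. Qed.

Lemma smooth_at_sum k n (f : nat -> R -> R) y :
  (forall i, (i < n)%N -> smooth_at k (f i) y) ->
  smooth_at k (fun x => \sum_(i < n) f i x) y.
Proof.
elim: n => [|n IH] cf.
  by apply: smooth_at_ext (smooth_at_cst k 0 y) => z; rewrite big_ord0.
have cn : smooth_at k (fun x => \sum_(i < n) f i x) y.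
  by apply: IH => i ni; apply: cf; rewrite ltnS ltnW.
apply: smooth_at_ext (smooth_at_add cn (cf n (ltnSn n))) => z.
by rewrite big_ord_recr.
Qed.

Lemma smooth_at_continuous k h y : smooth_at k h y -> {for y, continuous h}.
Proof. by move=> [U [_ Uy /(Ck_le (leq0n k)) c]]; exact: c _ Uy. Qed.

Lemma smooth_at_comp k h u y : smooth_at k h y -> smooth_at k u (h y) ->
  smooth_at k (u \o h) y.
Proof.
move=> sh [U' [oU' U'y cu]]; have ch := smooth_at_continuous sh.
have [U [oU Uy cU]] := sh.
exists (U `&` (h @^-1` U')°).
have oUU : open (U `&` (h @^-1` U')°) by apply: openI => //;
  exact: open_interior.
split => //.
  by split=> //; apply: ch; exact: open_nbhs_nbhs.
apply: (Ck_comp_real oUU _ _ cu) => [x [_ /interior_subset //]|].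
by apply: Ck_sub cU => x [].
Qed.

Lemma smooth_at_pospow k h y : smooth_at k h y ->
  smooth_at k (fun x => pospow k (h x)) y.
Proof.
move=> sh; apply: (smooth_at_comp sh).
by exists setT; split=> //; [exact: openT|exact: Ck_pospow].
Qed.

Lemma smooth_at_norm k h y : h y != 0 -> smooth_at k h y ->
  smooth_at k (fun x => `|h x|) y.
Proof.
move=> hy sh; apply: (smooth_at_comp (u := fun x => `|x|) sh).
exists [set x : R^o | x != 0]; split=> //.
exact: Ck_norm.
Qed.

Lemma smooth_at_derivable k h y : smooth_at k.+1 h y -> derivable h y 1.
Proof. by move=> [U [_ Uy [dh _]]]; apply: diff_derivable; exact: dh. Qed.

Lemma smooth_at_derive1 k h y : smooth_at k.+1 h y ->
  smooth_at k (h^`())%classic y.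
Proof. by move=> [U [oU Uy ch]]; exists U; split=> //; exact: Ck_derive1. Qed.

Lemma smooth_at_primitive k (F h : R -> R) y :
  (\forall x \near y, deriv F x (h x)) -> smooth_at k h y ->
  smooth_at k.+1 F y.
Proof.
move=> dF [U [oU Uy ch]].
pose U' : set R^o := U `&` [set x | deriv F x (h x)]°.
have oU' : open U' by apply: openI => //; exact: open_interior.
exists U'; split=> //.
apply: (Ck_primitive oU' (h := h)); first by move=> x [_ /interior_subset].
by apply: Ck_sub ch => x [].
Qed.

Lemma primitive_exists (h : R -> R) (d : R) : 0 < d ->
  (forall t, `|t| <= d -> {for t, continuous h}) ->
  exists F : R -> R, forall t, `|t| < d -> deriv F t (h t).
Proof.
move=> d0 ch.
have hi : lebesgue_measure.-integrable `[(- d), d] (EFin \o h).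
  apply: continuous_compact_integrable; first exact: segment_compact.
  apply: continuous_in_subspaceT => t; rewrite inE /= in_itv /= => td.
  by apply: ch; rewrite ler_norml.
exists (fun x => \int[lebesgue_measure]_(t in [set` `[(- d), x]]) h t) => t td.
have [td1 td2] : - d < t /\ t < d by move: td; rewrite ltr_norml => /andP.
have [D1 D2] := continuous_FTC1_closed td2 hi td1 (ch t (ltW td)).
by apply: DeriveDef => //; rewrite -derive1E.
Qed.

(** No inverse germ is carried along; where injectivity is wanted, [local_diffeo_inj] extracts it
    from the derivative. *)
Definition local_diffeo k h y : Prop := smooth_at k.+1 h y /\
  (h^`())%classic y != 0.

Lemma local_diffeo_id k y : local_diffeo k id y.
Proof. by split; [exact: smooth_at_id|rewrite derive1_id oner_neq0]. Qed.

Lemma local_diffeo_comp k h u y : local_diffeo k h y ->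
  local_diffeo k u (h y) -> local_diffeo k (u \o h) y.
Proof.
move=> [sh h0] [su u0]; split; first exact: smooth_at_comp.
by rewrite (derive1_comp (smooth_at_derivable sh) (smooth_at_derivable su))
  mulf_neq0.
Qed.

Lemma local_diffeo_eq k h u y : (\forall z \near y, h z = u z) ->
  local_diffeo k h y -> local_diffeo k u y.
Proof.
move=> hu [sh h0]; split; first exact: smooth_at_eq sh.
by rewrite derive1E -(@near_eq_derive R R^o R^o h u y 1 hu) -derive1E.
Qed.

Lemma local_diffeo_continuous k h y : local_diffeo k h y ->
  {for y, continuous h}.
Proof. by case=> /smooth_at_continuous. Qed.

Lemma local_diffeo_near k h y : local_diffeo k h y ->
  \forall z \near y, local_diffeo k h z.
Proof.
move=> [sh h0].
have /smooth_at_continuous ch := smooth_at_derive1 sh.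
have h0' : \forall z \near y, (h^`())%classic z != 0.
  by apply: (ch [set w | w != 0]);
    exact: open_nbhs_nbhs (conj (@open_neq R 0) h0).
by apply: filterS2 (smooth_at_near sh) h0'.
Qed.

(** Differentiating [u (h z) = z] at [y] shows that the derivative of [h] is invertible. *)
Lemma local_diffeo_inverse k h u y : smooth_at k.+1 h y ->
  smooth_at k.+1 u (h y) ->
  (\forall z \near y, u (h z) = z) -> local_diffeo k h y.
Proof.
move=> sh su uh; split=> //; apply: contraTneq isT => h0.
have := @near_eq_derive R R^o R^o (u \o h) id y 1 uh;
  rewrite derive_id -derive1E.
rewrite (derive1_comp (smooth_at_derivable sh) (smooth_at_derivable su)) h0
  mulr0.
by move/esym/eqP; rewrite oner_eq0.
Qed.

(** The difference quotients at [y] tend to a nonzero limit, so none of them vanishes near [y]. Only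
    the fibre of [h] through [y] is controlled, which is enough to single out one plaque. *)
Lemma local_diffeo_inj k h y : local_diffeo k h y ->
  \forall z \near y, h z = h y -> z = y.
Proof.
move=> [sh h0]; have /derivable1_diffP dh := smooth_at_derivable sh.
have cv : t^-1 *: ((h \o shift y) (t *: 1) - h y) @[t --> 0^'] --> 'D_1 h y.
  exact: (smooth_at_derivable sh).
have := cv [set w | w != 0]; rewrite -derive1E.
move=> /(_ (open_nbhs_nbhs (conj (@open_neq R 0) h0))).
rewrite /nbhs /= => /nbhs_ballP[e /= e0 he].
apply/nbhs_ballP; exists e => //= z; rewrite /ball /= => zy hzy.
apply: contraTeq isT => zney.
have := he (z - y); rewrite /ball /= sub0r normrN distrC subr_eq0 =>
  /(_ zy zney).
by rewrite /= [_%:A]mulr1 subrK hzy subrr scaler0 eqxx.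
Qed.

End SmoothAt.

(** * First integrals in foliated charts *)

Section Charts.
Context {R : realType} {n : nat} {M : topologicalType}.
Implicit Types (phi psi : chart R n M) (p q : M).

Lemma cmap_cont phi p : cdom phi p -> {for p, continuous (cmap phi)}.
Proof.
move=> dp; have := @cmap_continuous _ _ _ phi.
by rewrite (continuous_open_subspace _ (@cdom_open _ _ _ phi)); apply;
  rewrite inE.
Qed.

Lemma cinv_cont phi x : cimg phi x -> {for x, continuous (cinv phi)}.
Proof.
move=> dx; have := @cinv_continuous _ _ _ phi.
by rewrite (continuous_open_subspace _ (@cimg_open _ _ _ phi)); apply;
  rewrite inE.
Qed.

Lemma cdom_nbhs phi p : cdom phi p -> \forall q \near p, cdom phi q.
Proof. by move=> dp; apply: open_nbhs_nbhs; split=> //; exact: cdom_open. Qed.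

Lemma cimg_nbhs phi x : cimg phi x -> \forall y \near x, cimg phi y.
Proof. by move=> dp; apply: open_nbhs_nbhs; split=> //; exact: cimg_open. Qed.

Lemma cimg_cmap phi p : cdom phi p -> cimg phi (cmap phi p).
Proof. by move=> dp; exists p. Qed.

Lemma cinv_cdom phi x : cimg phi x -> cdom phi (cinv phi x).
Proof. by move=> [p dp <-]; rewrite cmapK. Qed.

Lemma cinvK phi x : cimg phi x -> cmap phi (cinv phi x) = x.
Proof. by move=> [p dp <-]; rewrite cmapK. Qed.

Lemma near_cinv phi p (P : M -> Prop) : cdom phi p ->
  (\forall q \near p, P q) ->
  \forall x \near cmap phi p, P (cinv phi x).
Proof.
move=> dp nP; have := cinv_cont (cimg_cmap dp);
  rewrite /prop_for /continuous_at.
by rewrite (cmapK dp); exact.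
Qed.

Lemma near_cmap phi p (P : 'rV[R]_n -> Prop) : cdom phi p ->
  (\forall x \near cmap phi p, P x) -> \forall q \near p, P (cmap phi q).
Proof. by move=> dp nP; exact: (cmap_cont dp). Qed.

Lemma open_cmap_image phi (D : set M) : open D ->
  open (cmap phi @` (cdom phi `&` D)).
Proof.
move=> oD; rewrite openE => _ [p [dp Dp] <-]; rewrite /interior.
have nD : \forall q \near p, D q by apply: open_nbhs_nbhs.
apply: filterS2 (near_cinv dp nD) (cimg_nbhs (cimg_cmap dp)) => x Dx cx.
by exists (cinv phi x); [split=> //; exact: cinv_cdom|exact: cinvK].
Qed.

End Charts.

Lemma derive1_diff {R : realType} (V : normedModType R) (f : V -> R^o) (h : R ->
  R) (x v : V) :
  differentiable f x -> derivable h (f x) 1 ->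
  'd ((h : R^o -> R^o) \o f) x v = (h^`())%classic (f x) * 'd f x v.
Proof.
move=> df /derivable1_diffP dh; rewrite (diff_comp df dh) /=.
rewrite derive1E' // -[X in 'd _ _ X = _]mulr1 [LHS]linearZ /=.
by rewrite [LHS]mulrC.
Qed.

Section FoliatedCharts.
Context {R : realType} {m : nat} {M : topologicalType}.
Variables (k : nat) (A F : set (chart R m.+1 M)).
Hypotheses (atlasA : Cr_atlas k.+1 A) (folF : Cr_foliation k.+1 A F).
Implicit Types (phi psi : chart R m.+1 M) (p q : M).

Definition tdir : 'rV[R]_m.+1 := delta_mx ord0 ord_max.

(** The transversal through [p] in the chart [phi], parametrized by its transverse coordinate. *)
Definition tline phi p (y : R) : M :=
  cinv phi (cmap phi p + (y - tcoord phi p) *: tdir).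

Lemma fol_chart p : exists2 phi, F phi & cdom phi p.
Proof.
have [cF _ _ _] := folF; have : [set: M] p by [].
by rewrite -cF => -[phi]; exists phi.
Qed.

Lemma atlas_chart p : exists2 phi, A phi & cdom phi p.
Proof.
have [cA _] := atlasA; have : [set: M] p by [].
by rewrite -cA => -[phi]; exists phi.
Qed.

Lemma fol_change phi psi p : F phi -> F psi -> cdom phi p -> cdom psi p ->
  exists h, transverse_change phi psi p h.
Proof. by move=> Fphi Fpsi; have [_ _ _] := folF; exact. Qed.

Lemma tdirE (x : 'rV[R]_m.+1) c : (x + c *: tdir) ord0 ord_max = x ord0 ord_max
  + c.
Proof. by rewrite !mxE !eqxx mulr1. Qed.

Lemma tline_cimg phi p : cdom phi p ->
  \forall y \near tcoord phi p, cimg phi (cmap phi p + (y - tcoord phi p) *: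
    tdir).
Proof.
move=> dp; have c : {for tcoord phi p,
    continuous (fun y : R => cmap phi p + (y - tcoord phi p) *: tdir)}.
  apply: cvgD; first exact: cvg_cst.
  by apply: cvgZr_tmp; apply: cvgB; [exact: cvg_id|exact: cvg_cst].
move: c; rewrite /prop_for /continuous_at subrr scale0r addr0; apply.
exact: cimg_nbhs (cimg_cmap dp).
Qed.

Lemma tcoord_tline phi p y : cimg phi (cmap phi p + (y - tcoord phi p) *: tdir)
  ->
  tcoord phi (tline phi p y) = y.
Proof. by move=> ci; rewrite {1}/tcoord /tline (cinvK ci) tdirE addrC subrK.
  Qed.

Lemma tline_tcoord phi p : cdom phi p -> tline phi p (tcoord phi p) = p.
Proof. by move=> dp; rewrite /tline subrr scale0r addr0 cmapK. Qed.

Lemma tline_cont phi p y : cimg phi (cmap phi p + (y - tcoord phi p) *: tdir) ->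
  {for y, continuous (tline phi p)}.
Proof.
move=> ci; apply: (@continuous_comp _ _ _
  (fun y : R => cmap phi p + (y - tcoord phi p) *: tdir));
    last exact: cinv_cont.
apply: cvgD; first exact: cvg_cst.
by apply: cvgZr_tmp; apply: cvgB; [exact: cvg_id|exact: cvg_cst].
Qed.

Lemma near_tline phi p (P : M -> Prop) : cdom phi p ->
  (\forall q \near p, P q) ->
  \forall y \near tcoord phi p, P (tline phi p y).
Proof.
move=> dp nP; have := @tline_cont phi p (tcoord phi p).
rewrite /prop_for /continuous_at subrr scale0r addr0 (tline_tcoord dp).
by move=> /(_ (cimg_cmap dp)); exact.
Qed.

(** The transversal [tline phi p] is a continuous local section of [tcoord phi] through [p], so
    [tcoord phi] is open at [p]. *)
Lemma near_tcoord phi p (P : R -> Prop) : cdom phi p ->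
  (\forall q \near p, P (tcoord phi q)) -> \forall y \near tcoord phi p, P y.
Proof.
move=> dp nP; apply: filterS2 (near_tline dp nP) (tline_cimg dp) => y Py ci.
by rewrite -(tcoord_tline ci).
Qed.

Lemma tcoord_cont phi p : cdom phi p -> {for p, continuous (tcoord phi)}.
Proof.
move=> dp.
exact: (continuous_comp (cmap_cont dp) (@coord_continuous _ _ _ _ _ (cmap phi
  p))).
Qed.

Lemma Ck_tcoord phi psi : F phi -> A psi ->
  Ck k.+1 (cmap psi @` (cdom phi `&` cdom psi)) (tcoord phi \o cinv psi : _ ->
    R^o).
Proof.
move=> Fphi Apsi; have [_ _ /(_ _ _ Fphi Apsi)[_ c] _] := folF.
apply: (Ck_coord (f := cmap phi \o cinv psi) ord_max _ c).
by rewrite setIC; apply: open_cmap_image; exact: cdom_open.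
Qed.

(** By definition a foliated chart is compatible with the charts of [A]; compatibility of two
    foliated charts is obtained by factoring the change through a chart [al] of [A]. *)
Lemma smooth_tcoord_tline phi psi p : F phi -> F psi -> cdom phi p ->
  cdom psi p ->
  smooth_at k.+1 (tcoord psi \o tline phi p) (tcoord phi p).
Proof.
move=> Fphi Fpsi dp dq; have [al Aal dal] := atlas_chart p.
have [_ _ /(_ _ _ Fphi Aal)[c _] _] := folF.
have oU := open_cmap_image (phi :=
  phi) (openI (@cdom_open _ _ _ psi) (@cdom_open _ _ _ al)).
set U := cmap phi @` _ in oU.
have cU : Ck k.+1 U (tcoord psi \o cinv phi : _ -> R^o).
  apply: (Ck_eq (f := (tcoord psi \o cinv al : _ ->
    R^o) \o (cmap al \o cinv phi)) oU).
    by move=> _ [q [dq1 [dq2 dq3]] <-]; rewrite /= !cmapK // !cmapK.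
  apply: (Ck_comp_rV oU _ _ (Ck_tcoord Fpsi Aal)).
    by move=> _ [q [dq1 [dq2 dq3]] <-] /=; rewrite cmapK //; exists q.
  by apply: Ck_sub c => _ [q [dq1 [dq2 dq3]] <-]; exists q.
have lE y : cmap phi p + (y - tcoord phi p) *: tdir =
    (cmap phi p - tcoord phi p *: tdir) + y *: tdir.
  by rewrite scalerBl addrA addrAC.
pose l (y : R^o) : 'rV[R]_m.+1 :=
  (cmap phi p - tcoord phi p *: tdir) + y *: tdir.
have cl : continuous l.
  move=> y; apply: cvgD; first exact: cvg_cst.
  by apply: cvgZr_tmp; exact: cvg_id.
have oV : open (l @^-1` U) by apply: open_comp => // y _; exact: cl.
exists (l @^-1` U); split => //.
  by exists p; [split|rewrite /l -lE subrr scale0r addr0].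
apply: (Ck_eq (f := (tcoord psi \o cinv phi : _ -> R^o) \o l) oV).
  by move=> y _; rewrite /= /tline lE.
by apply: (Ck_comp_line oV _ cU).
Qed.

(** The definition of [transverse_change] says nothing about regularity. Restriction to the
    transversal through [p] identifies the germ of [g] with that of [tcoord psi] along
    [tline phi p]. *)
Lemma smooth_change phi psi p g : F phi -> F psi -> cdom phi p -> cdom psi p ->
  transverse_change phi psi p g -> smooth_at k.+1 g (tcoord phi p).
Proof.
move=> Fphi Fpsi dp dq tc;
  apply: smooth_at_eq (smooth_tcoord_tline Fphi Fpsi dp dq).
apply: filterS2 (near_tline dp tc) (tline_cimg dp) => y /= -> ci.
by rewrite tcoord_tline.
Qed.

Lemma change_eq phi psi p g : cdom phi p -> transverse_change phi psi p g ->
  g (tcoord phi p) = tcoord psi p.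
Proof. by move=> dp /nbhs_singleton ->. Qed.

Lemma change_inverse phi psi p g g' : cdom phi p ->
  transverse_change phi psi p g -> transverse_change psi phi p g' ->
  \forall y \near tcoord phi p, g' (g y) = y.
Proof.
move=> dp tc tc'; apply: (near_tcoord (P := fun y => g' (g y) = y) dp).
by apply: filterS2 tc tc' => q <- <-.
Qed.

Lemma local_diffeo_change phi psi p g : F phi -> F psi -> cdom phi p ->
  cdom psi p ->
  transverse_change phi psi p g -> local_diffeo k g (tcoord phi p).
Proof.
move=> Fphi Fpsi dp dq tc; have [g' tc'] := fol_change Fpsi Fphi dq dp.
apply: (local_diffeo_inverse (smooth_change Fphi Fpsi dp dq tc) _
  (change_inverse dp tc tc')).
by rewrite (change_eq dp tc); exact: smooth_change tc'.
Qed.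

Definition first_integral_at (g : M -> R) p : Prop :=
  forall psi, F psi -> cdom psi p -> exists2 h,
    local_diffeo k h (tcoord psi p) & \forall q \near p, g q = h (tcoord psi q).

(** Changes of foliated charts act on the transverse coordinate by local diffeomorphisms, so
    checking one chart at [p] is enough. *)
Lemma first_integral_chart g p phi h : F phi -> cdom phi p ->
  local_diffeo k h (tcoord phi p) ->
    (\forall q \near p, g q = h (tcoord phi q)) ->
  first_integral_at g p.
Proof.
move=> Fphi dp lh gh psi Fpsi dq; have [t tc] := fol_change Fpsi Fphi dq dp.
exists (h \o t); last by apply: filterS2 gh tc => q -> ->.
apply: local_diffeo_comp; first exact: local_diffeo_change tc.
by rewrite (change_eq dq tc).
Qed.

Lemma first_integral_near g p : first_integral_at g p ->
  \forall q \near p, first_integral_at g q.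
Proof.
move=> gp; have [phi Fphi dp] := fol_chart p; have [h lh gh] := gp _ Fphi dp.
have lh' := tcoord_cont dp (local_diffeo_near lh).
near=> q; apply: (@first_integral_chart g q phi h) => //.
- by near: q; exact: cdom_nbhs.
- by near: q; exact: lh'.
- by near: q; exact: (near_join gh).
Unshelve. all: by end_near. Qed.

Lemma first_integral_eq f g p : (\forall q \near p, f q = g q) ->
  first_integral_at f p -> first_integral_at g p.
Proof.
move=> fg fp psi Fpsi dq; have [h lh fh] := fp _ Fpsi dq.
by exists h => //; apply: filterS2 fg fh => q -> ->.
Qed.

Lemma first_integral_cont g p : first_integral_at g p -> {for p, continuous g}.
Proof.
move=> gp; have [phi Fphi dp] := fol_chart p; have [h lh gh] := gp _ Fphi dp.
have c := continuous_comp (tcoord_cont dp) (local_diffeo_continuous lh).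
rewrite /prop_for /continuous_at (nbhs_singleton gh).
apply: cvg_trans c; apply: near_eq_cvg; near=> q; apply/esym; near: q;
  exact: gh.
Unshelve. all: by end_near. Qed.

Lemma first_integral_comp g p u : first_integral_at g p ->
  local_diffeo k u (g p) ->
  first_integral_at (u \o g) p.
Proof.
move=> gp lu psi Fpsi dq; have [h lh gh] := gp _ Fpsi dq.
exists (u \o h); last by apply: filterS gh => q /= ->.
by apply: local_diffeo_comp => //; rewrite -(nbhs_singleton gh).
Qed.

(** The transversal is based at [q] while the conclusion concerns its point [p]: boxes need it along
    a whole transversal and not only at the base point. *)
Lemma first_integral_tline g p psi q : F psi -> cdom psi q ->
  cimg psi (cmap psi q + (tcoord psi p - tcoord psi q) *: tdir) ->
  p = tline psi q (tcoord psi p) -> first_integral_at g p ->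
  local_diffeo k (g \o tline psi q) (tcoord psi p).
Proof.
move=> Fpsi dq ci pE gp.
have dp : cdom psi p by rewrite pE; exact: cinv_cdom.
have [h lh gh] := gp _ Fpsi dp.
have n1 : \forall y \near tcoord psi p,
    g (tline psi q y) = h (tcoord psi (tline psi q y)).
  by have := tline_cont ci; rewrite /prop_for /continuous_at -pE => /(_ _ gh).
have n2 : \forall y \near tcoord psi p, cimg psi (cmap psi q + (y - tcoord psi
  q) *: tdir).
  have c : {for tcoord psi p,
      continuous (fun y : R => cmap psi q + (y - tcoord psi q) *: tdir)}.
    apply: cvgD; first exact: cvg_cst.
    by apply: cvgZr_tmp; apply: cvgB; [exact: cvg_id|exact: cvg_cst].
  exact: c (cimg_nbhs ci).
apply: local_diffeo_eq lh; near=> y.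
rewrite /= (near n1 y) // tcoord_tline //; by near: y.
Unshelve. all: by end_near. Qed.

End FoliatedCharts.

(** * Holonomy along chains of plaques *)

Lemma continuous_concat {R : realType} {T : topologicalType} (f g : R ->
  T) (a : R) :
  continuous f -> continuous g -> f a = g a ->
  continuous (fun s => if s <= a then f s else g s).
Proof.
move=> cf cg fga s; case: (ltrgtP s a) => [sa|sa|->].
- rewrite /continuous_at (ltW sa); apply: (@cvg_trans _ (f @ s));
    last exact: cf.
  apply: near_eq_cvg.
  near=> t; rewrite ifT //; near: t; exact: (lt_le_nbhsl sa).
- rewrite /continuous_at leNgt sa /=; apply: (@cvg_trans _ (g @ s));
    last exact: cg.
  apply: near_eq_cvg.
  near=> t; rewrite ifF //; apply/negbTE; rewrite -ltNge; near: t.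
  exact: (@lt_nbhsr R a s sa).
- rewrite /continuous_at lexx => B nB; have cfa := cf a.
  have := cg a; rewrite /continuous_at -fga => cga.
  have nf : \forall t \near a, B (f t) by exact: cfa.
  have ng : \forall t \near a, B (g t) by exact: cga.
  have : \forall t \near a, B (if t <= a then f t else g t).
    by apply: filterS2 nf ng => t Bf Bg; case: ifP.
  exact.
Unshelve. all: by end_near. Qed.

Section Holonomy.
Context {R : realType} {m : nat} {M : topologicalType}.
Variables (k : nat) (A F : set (chart R m.+1 M)).
Hypotheses (atlasA : Cr_atlas k.+1 A) (folF : Cr_foliation k.+1 A F).
Implicit Types (phi psi : chart R m.+1 M) (p q : M).

Lemma leaf_refl p : leaf F p p. Proof. exact: rt_refl. Qed.

Lemma leaf_trans q p z : leaf F p q -> leaf F q z -> leaf F p z.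
Proof. exact: rt_trans. Qed.

Lemma leaf_step p q : same_plaque F p q -> leaf F p q.
Proof. exact: rt_step. Qed.

Lemma same_plaque_sym p q : same_plaque F p q -> same_plaque F q p.
Proof. by move=> [phi Fphi [dp dq e]]; exists phi. Qed.

Lemma leaf_sym p q : leaf F p q -> leaf F q p.
Proof.
elim=> [x y /same_plaque_sym|x|x y z _ xy _ yz].
- exact: leaf_step.
- exact: leaf_refl.
- exact: leaf_trans yz xy.
Qed.

(* [transport] with the path forgotten: chains of plaques can be reversed and
   concatenated without reparametrization, and [chain_realize] recovers a path.
     *)
Inductive chain_transport phi p : chart R m.+1 M -> M -> (R -> R) -> Prop :=
| chain_start : F phi -> cdom phi p -> chain_transport phi p phi p id
| chain_slide psi q h z : chain_transport phi p psi q h -> cdom psi z ->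
    tcoord psi z = tcoord psi q -> chain_transport phi p psi z h
| chain_change psi q h psi' g : chain_transport phi p psi q h -> F psi' ->
    cdom psi' q -> transverse_change psi psi' q g ->
    chain_transport phi p psi' q (g \o h).

Lemma chain_spec phi p psi q h : chain_transport phi p psi q h ->
  [/\ F phi, cdom phi p, F psi, cdom psi q &
      h (tcoord phi p) = tcoord psi q /\ local_diffeo k h (tcoord phi p)].
Proof.
elim=> [Fphi dp|{}psi {}q {}h z _ [? ? ? ? [<- ?]] dz ->|
  {}psi {}q {}h psi' g _ [Fphi dp Fpsi dq [hE lh]] Fpsi' dq' tc].
- by split=> //; split=> //; exact: local_diffeo_id.
- by split.
- split=> //; split; first by rewrite /= hE (change_eq dq tc).
  apply: local_diffeo_comp => //; rewrite hE.
  exact: (local_diffeo_change atlasA folF Fpsi Fpsi' dq dq' tc).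
Qed.

Lemma chain_trans phi p psi q h chi z g : chain_transport phi p psi q h ->
  chain_transport psi q chi z g -> chain_transport phi p chi z (g \o h).
Proof.
move=> ph; elim=> [_ _|{}chi {}z {}g w _ IH dw e|{}chi {}z {}g chi' g' _ IH
  Fchi' dz tc].
- exact: ph.
- exact: chain_slide IH dw e.
- exact: (chain_change IH Fchi' dz tc).
Qed.

(** Nothing is claimed about [g]; that it inverts [h] will follow from trivial holonomy, the two
    chains forming a loop. *)
Lemma chain_sym phi p psi q h : chain_transport phi p psi q h ->
  exists g, chain_transport psi q phi p g.
Proof.
elim=> [Fphi dp|{}psi {}q {}h z ph [g gt] dz e|{}psi {}q {}h psi' g ph [g' gt]
  Fpsi' dq' tc].
- by exists id; exact: chain_start.
- have [_ _ Fpsi dq _] := chain_spec ph; exists (g \o id).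
  by apply: chain_trans gt; apply: (chain_slide (chain_start Fpsi dz)).
- have [_ _ Fpsi dq _] := chain_spec ph.
  have [g2 tc2] := fol_change folF Fpsi' Fpsi dq' dq.
  exists (g' \o (g2 \o id)); apply: chain_trans gt.
  exact: (chain_change (chain_start Fpsi' dq')).
Qed.

Lemma chain_exists phi p psi q : leaf F p q -> F phi -> cdom phi p -> F psi ->
  cdom psi q -> exists h, chain_transport phi p psi q h.
Proof.
have change p' phi' psi' : F phi' -> cdom phi' p' -> F psi' -> cdom psi' p' ->
    exists h, chain_transport phi' p' psi' p' h.
  move=> Fphi dp Fpsi dq; have [g tc] := fol_change folF Fphi Fpsi dp dq.
  by exists (g \o id); exact: (chain_change (chain_start Fphi dp)).
move=> pq; elim: pq phi psi =>
  [x y [chi Fchi [dx dy e]]|x|x y z _ IH1 _ IH2] phi psi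
  Fphi dp Fpsi dq.
- have [h ph] := change _ _ _ Fphi dp Fchi dx.
  have [g pg] := change _ _ _ Fchi dy Fpsi dq.
  by exists (g \o h); apply: chain_trans pg; exact: (chain_slide ph).
- exact: change.
- have [chi Fchi dy] := fol_chart folF y.
  have [h ph] := IH1 _ _ Fphi dp Fchi dy;
    have [g pg] := IH2 _ _ Fchi dy Fpsi dq.
  by exists (g \o h); exact: chain_trans pg.
Qed.

(** A straight segment in the chart with time clamped to [0, 1]: constant before 0 and after 1, it
    is defined and continuous on all of R and can be concatenated. *)
Definition plaque_path phi p z (s : R) : M :=
  cinv phi (cmap phi p + Num.max 0 (Num.min 1 s) *: (cmap phi z - cmap phi p)).

Lemma clampP (s : R) : 0 <= Num.max 0 (Num.min 1 s) <= 1.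
Proof. by rewrite le_max lexx /= ge_max ler01 ge_min lexx. Qed.

Lemma plaque_path_cimg phi p z s : F phi -> cdom phi p -> cdom phi z ->
  cimg phi (cmap phi p + Num.max 0 (Num.min 1 s) *: (cmap phi z - cmap phi p)).
Proof.
move=> Fphi dp dz; have /andP[] := clampP s.
set t := Num.max _ _ => t0 t1.
(* The image of a foliated chart is a product of intervals, hence convex; this is checked one
   coordinate at a time. *)
have [_ /(_ _ Fphi)[J [oJ JE]] _ _] := folF.
have := cimg_cmap dz; have := cimg_cmap dp; rewrite JE => Jp Jz i.
have [_ iJ] := oJ i; rewrite !mxE.
case: (leP (cmap phi p ord0 i) (cmap phi z ord0 i)) => pz.
  by apply: (iJ _ _ (Jp i) (Jz i)); apply/andP; split; nra.
by apply: (iJ _ _ (Jz i) (Jp i)); apply/andP; split; nra.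
Qed.

Lemma plaque_path_tcoord phi p z s : F phi -> cdom phi p -> cdom phi z ->
  tcoord phi p = tcoord phi z ->
  cdom phi (plaque_path phi p z s) /\
    tcoord phi (plaque_path phi p z s) = tcoord phi p.
Proof.
move=> Fphi dp dz pz; have ci := plaque_path_cimg s Fphi dp dz.
split; first exact: cinv_cdom.
by rewrite {1}/tcoord /plaque_path (cinvK ci) !mxE -!/(tcoord _ _) pz subrr
  mulr0 addr0.
Qed.

Lemma plaque_path0 phi p z s : cdom phi p -> s <= 0 ->
  plaque_path phi p z s = p.
Proof.
move=> dp s0; rewrite /plaque_path (_ : Num.max _ _ = 0).
  by rewrite scale0r addr0 cmapK.
by rewrite max_l // ge_min s0 orbT.
Qed.

Lemma plaque_path1 phi p z s : cdom phi z -> 1 <= s ->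
  plaque_path phi p z s = z.
Proof.
move=> dz s1; rewrite /plaque_path (_ : Num.max _ _ = 1).
  by rewrite scale1r addrC subrK cmapK.
by rewrite (min_l s1) max_r.
Qed.

Lemma plaque_path_cont phi p z : F phi -> cdom phi p -> cdom phi z ->
  continuous (plaque_path phi p z).
Proof.
move=> Fphi dp dz s; apply: (@continuous_comp _ _ _
  (fun s : R => cmap phi p + Num.max 0 (Num.min 1 s) *: (cmap phi z - cmap phi
    p)));
  last exact/cinv_cont/plaque_path_cimg.
apply: cvgD; first exact: cvg_cst.
apply: cvgZr_tmp.
have c : {for s, continuous ((cst 0 : R^o -> R^o) \max ((cst 1 : R^o ->
  R^o) \min id))}.
  apply: continuous_max; first exact: cvg_cst.
  by apply: continuous_min; [exact: cvg_cst|exact: cvg_id].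
exact: c.
Qed.

(** The leaf topology is finer than that of [M], but a leaf-open set contains, around each of its
    points, all nearby points of the same plaque. A path staying locally in one plaque sees no
    difference. *)
Lemma plaque_continuous (c : R -> M) (s : R) phi : F phi -> cdom phi (c s) ->
  {for s, continuous c} ->
  (\forall s' \near s, cdom phi (c s') /\
    tcoord phi (c s') = tcoord phi (c s)) ->
  {for s, continuous (c : R -> leaf_space F)}.
Proof.
move=> Fphi dp cc nc B; rewrite nbhsE => -[V [oV Vp] VB].
have nV : \forall s' \near s, cdom phi (c s') ->
    tcoord phi (c s') = tcoord phi (c s) -> V (c s').
  exact: (cc _ (oV phi (c s) Fphi dp Vp)).
by apply: filterS2 nV nc => s' Vs' [ds' es']; apply: VB; exact: Vs'.
Qed.

(** Running the path twice as fast frees the time after t / 2 for one more plaque. *)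
Lemma transport_half c phi t psi h : transport F c phi t psi h ->
  forall c', (forall s, s <= t -> c' (s / 2) = c s) ->
    transport F c' phi (t / 2) psi h.
Proof.
elim=> {t psi h} [Fphi dp c' cc'|t t' psi h _ IH tt' dc c' cc'|t psi psi' h g _
  IH Fpsi' dc tc c' cc'].
- rewrite mul0r; apply: transport_start => //.
  by have := cc' 0 (lexx 0); rewrite mul0r => ->.
- apply: (@transport_plaque _ _ _ _ _ _ (t / 2)).
  + by apply: IH => s st; apply: cc'; exact: le_trans tt'.
  + by rewrite ler_pM2r.
  + move=> s /andP[s1 s2].
    have -> : s = (s * 2) / 2 by field.
    rewrite cc'; last by lra.
    by apply: dc; apply/andP; split; lra.
- have e := cc' t (lexx t);
    apply: (@transport_change _ _ _ _ _ _ (t / 2) psi) => //.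
  + exact: IH.
  + by rewrite e.
  + by rewrite e.
Qed.

(** Induction on the chain: a slide appends a segment of the plaque to the path run at double speed,
    a change of chart keeps the path. Constancy outside [0, 1] is carried along so that the pieces
    fit. *)
Lemma chain_realize phi p psi q h : chain_transport phi p psi q h ->
  exists c : R -> M, [/\ continuous (c : R -> leaf_space F),
    forall s, s <= 0 -> c s = p, forall s, 1 <= s -> c s = q &
    transport F c phi 1 psi h].
Proof.
elim=> [Fphi dp|{}psi {}q {}h z ph [c [cc c0 c1 tr]] dz e|{}psi {}q {}h psi' g _
  [c [cc c0 c1 tr]] Fpsi' dq tc].
- exists (fun=> p); split => //; first by move=> s; exact: cst_continuous.
  apply: (@transport_plaque _ _ _ _ _ _ 0) => //.
  exact: transport_start.
- have [Fphi dp Fpsi dq _] := chain_spec ph.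
  pose sg := plaque_path psi q z.
  pose c' s := if s <= 2^-1 then c (s * 2) else sg (s * 2 - 1).
  exists c'; split.
  + have cd : continuous (fun s : R => s * 2).
      by move=> s; apply: cvgM; [exact: cvg_id|exact: cvg_cst].
    apply: (@continuous_concat _ (leaf_space F) (fun s => c (s * 2)) (fun s =>
      sg (s * 2 - 1))).
    * by move=> s; apply: (continuous_comp (cd s)); exact: cc.
    * have csg : continuous (sg : R -> leaf_space F).
        move=> s; have [d1 t1] := plaque_path_tcoord s Fpsi dq dz (esym e).
        apply: (@plaque_continuous sg s psi Fpsi d1 (@plaque_path_cont psi q z
          Fpsi dq dz s)).
        near=> s'; have [d2 t2] := plaque_path_tcoord s' Fpsi dq dz (esym e).
        by split=> //; rewrite t2.
      move=> s; apply: (@continuous_comp _ _ _ (fun s : R => s * 2 - 1));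
        last exact: csg.
      by apply: cvgB; [exact: cd|exact: cvg_cst].
    * by rewrite mulVf // subrr c1 // /sg plaque_path0.
  + by move=> s s0; rewrite /c' ifT ?c0 //; lra.
  + move=> s s1; rewrite /c' ifF; last by apply/negbTE; rewrite -ltNge; lra.
    by apply: plaque_path1 => //; lra.
  + apply: (@transport_plaque _ _ _ _ _ _ (1 / 2)); last 2 first.
    * lra.
    * move=> s /andP[s1 s2]; rewrite /c'; case: ifP => _; last first.
        by have [] := plaque_path_tcoord (s * 2 - 1) Fpsi dq dz (esym e).
      by rewrite c1 //; lra.
    * apply: (transport_half tr) => s s1; rewrite /c' ifT; last by lra.
      by congr (c _); field.
- exists c; split => //; apply: (transport_change tr) => //; by rewrite c1.
Unshelve. all: by end_near. Qed.

(** * Uniqueness of transport under trivial holonomy *)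

Hypothesis holF : forall L, is_leaf F L -> trivial_holonomy F L.

(** The path realizing the chain is a loop in the leaf, so the germ of [h] belongs to the holonomy
    group at [p]. *)
Lemma chain_loop phi p h : chain_transport phi p phi p h ->
  \forall y \near tcoord phi p, h y = y.
Proof.
move=> ph; have [Fphi dp _ _ _] := chain_spec ph.
have [c [cc c0 c1 tr]] := chain_realize ph.
have tl := holF (ex_intro _ p erefl) (leaf_refl p) Fphi dp.
have : holonomy_group F phi p (germ (tcoord phi p) h).
  exists h => //; exists c => //; split; [|exact: c0|exact: c1].
  exact: continuous_subspaceT.
rewrite tl /= => gE.
have : germ (tcoord phi p) h h by rewrite /germ /=; near=> z.
by rewrite gE.
Unshelve. all: by end_near. Qed.

(** A reverse [g] of the second chain closes both chains into loops: [g \o h] and [h' \o g] are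
    germs of the identity, whence h = h' o g o h = h'. *)
Lemma chain_unique phi p psi q h h' : chain_transport psi q phi p h ->
  chain_transport psi q phi p h' -> \forall y \near tcoord psi q, h y = h' y.
Proof.
move=> ph ph'; have [g pg] := chain_sym ph'.
have [_ _ _ _ [hE lh]] := chain_spec ph.
have l1 := chain_loop (chain_trans ph pg);
  have l2 := chain_loop (chain_trans pg ph').
have c := local_diffeo_continuous lh; rewrite /prop_for /continuous_at hE in c.
have l3 : \forall y \near tcoord psi q, (h' \o g) (h y) = h y by exact: c _ l2.
by apply: filterS2 l1 l3 => y /= e1 e2; rewrite -[LHS]e2 /= e1.
Qed.

Lemma chain_germ_unique phi p psi psi' q h h' : chain_transport psi q phi p h ->
  chain_transport psi' q phi p h' ->
  \forall x \near q, h (tcoord psi x) = h' (tcoord psi' x).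
Proof.
move=> ph ph'; have [Fpsi dq _ _ _] := chain_spec ph.
have [Fpsi' dq' _ _ _] := chain_spec ph'.
have [g tc] := fol_change folF Fpsi Fpsi' dq dq'.
have u := chain_unique ph (chain_trans (chain_change (chain_start Fpsi dq) Fpsi'
  dq' tc) ph').
have u' : \forall x \near q, h (tcoord psi x) = (h' \o (g \o id)) (tcoord psi
  x).
  exact: tcoord_cont dq _ u.
by apply: filterS2 u' tc => x /= -> ->.
Qed.

End Holonomy.

(** * Reeb stability *)

Lemma connected_clopen {T : topologicalType} (B : set T) : connected [set: T] ->
  B !=set0 -> open B -> closed B -> B = setT.
Proof.
move=> cT B0 oB cB; apply: cT => //; first by exists B; rewrite ?setTI.
by exists B; rewrite ?setTI.
Qed.

Lemma connected_real {R : realType} : connected [set: R].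
Proof. by apply/connected_intervalP. Qed.

Lemma near_all_seq {T : topologicalType} {I : eqType} (x : T) (s : seq I)
    (P : I -> T -> Prop) : (forall i, i \in s -> \forall y \near x, P i y) ->
  \forall y \near x, forall i, i \in s -> P i y.
Proof.
elim: s => [|i s IH] Ps; first by near=> y.
have h1 := Ps i (mem_head i s).
have h2 : \forall y \near x, forall j, j \in s -> P j y.
  by apply: IH => j js; apply: Ps; rewrite in_cons js orbT.
apply: filterS2 h1 h2 => y P1 P2 j; rewrite in_cons => /orP[/eqP ->//|];
  exact: P2.
Unshelve. all: by end_near. Qed.

(** The filter [Fs], of finite sequences in [K] ordered by inclusion, turns the near-covering form
    of compactness into the extraction of a finite subcover centred at points of [K]. *)
Lemma compact_subcover {T : topologicalType} (K : set T) (N : T -> set T) :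
  compact K -> (forall x, K x -> nbhs x (N x)) ->
  exists s : seq T, (forall i, i \in s -> K i) /\
    forall x, K x -> exists2 i, i \in s & N i x.
Proof.
move=> /compact_near_coveringP cK nN.
pose Fs : set_system (seq T) := [set S : set (seq T) | exists s0 : seq T,
  (forall i, i \in s0 -> K i) /\
  forall s : seq T, (forall i, i \in s -> K i) -> {subset s0 <= s} -> S s].
have fF : Filter Fs.
  split; first by exists [::].
  - move=> S S' [s [sK sS]] [s' [s'K s'S]]; exists (s ++ s'); split.
      by move=> i; rewrite mem_cat => /orP[/sK|/s'K].
    move=> t tK sub; split.
      by apply: sS => // i si; apply: sub; rewrite mem_cat si.
    by apply: s'S => // i si; apply: sub; rewrite mem_cat si orbT.
  - by move=> S S' SS' [s [sK sS]]; exists s; split=> // t tK sub; exact/SS'/sS.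
have [] := cK _ Fs (fun s x => exists2 i, i \in s & N i x) fF.
  move=> x Kx; exists (N x, [set s : seq T | x \in s]) => /=.
    split; first exact: nN.
    exists [:: x]; split; first by move=> i; rewrite inE => /eqP ->.
    by move=> s _ sub; apply: sub; rewrite inE.
  by move=> [y s] /= [Ny xs]; exists x.
by move=> s [sK sP]; exists s; split=> //; exact: sP.
Qed.

Section Box.
Context {R : realType} {m : nat} {M : topologicalType}.
Variables (k : nat) (A F : set (chart R m.+1 M)).
Hypotheses (hM : hausdorff_space M) (atlasA : Cr_atlas k.+1 A)
  (folF : Cr_foliation k.+1 A F).
Implicit Types (phi psi : chart R m.+1 M) (p q : M).

(** Local compactness of [M], from a small closed cube in a foliated chart. *)
Lemma compact_nbhs_point p (N : set M) : nbhs p N ->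
  exists C, [/\ compact C, nbhs p C & C `<=` N].
Proof.
move=> nN; have [phi Fphi dp] := fol_chart folF p.
have n1 : \forall x \near cmap phi p, N (cinv phi x) /\ cimg phi x.
  by apply: filterS2 (near_cinv dp nN) (cimg_nbhs (cimg_cmap dp)).
have /nbhs_ballP[e /= e0 he] := n1.
set x0 := cmap phi p in n1 he.
pose D : set 'rV[R]_m.+1 := [set v | forall i,
  [set` `[x0 ord0 i - e / 2, x0 ord0 i + e / 2]] (v ord0 i)].
have DB : D `<=` ball x0 e.
  move=> v Dv; split=> // i j; have := Dv j;
    rewrite (ord1 i) /= in_itv /= => /andP[h1 h2].
  by rewrite /ball /= ltr_norml; apply/andP; split; lra.
have cD : compact D by exact: (@rV_compact R _ (fun i =>
  [set` `[x0 ord0 i - e / 2, x0 ord0 i + e / 2]])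
    (fun i => @segment_compact _ _ _)).
exists (cinv phi @` D); split.
- apply: continuous_compact => //; apply: continuous_in_subspaceT => v.
  by rewrite inE => /DB/he[_ cv]; exact: cinv_cont.
- have nD : \forall x \near x0, D x.
    apply/nbhs_ballP; exists (e / 2) => /=; first by rewrite divr_gt0.
    move=> v [_ xv] i; have := xv ord0 i;
      rewrite /ball /= ltr_norml => /andP[h1 h2].
    by rewrite in_itv /=; apply/andP; split; lra.
  apply: filterS2 (near_cmap dp nD) (cdom_nbhs dp) => q Dq dq.
  by exists (cmap phi q) => //; rewrite cmapK.
- by move=> _ [v Dv <-]; have [] := he v (DB v Dv).
Qed.

Lemma compact_nbhs_set (L N : set M) : compact L -> (forall x, L x ->
  nbhs x N) ->
  exists C, [/\ compact C, L `<=` C° & C `<=` N].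
Proof.
move=> cL LN.
have ch x : {C | L x -> [/\ compact C, nbhs x C & C `<=` N]}.
  apply: cid; have [Lx|nLx] := pselect (L x); last by exists set0.
  by have [C ?] := compact_nbhs_point (LN _ Lx); exists C.
pose C x := sval (ch x).
have CP x : L x -> [/\ compact (C x), nbhs x (C x) &
  C x `<=` N] by exact: svalP (ch x).
have [s [sL sC]] := compact_subcover (N := fun x => (C x)°) cL
  (fun x Lx => nbhs_interior (let: And3 _ h _ := CP x Lx in h)).
exists (\big[setU/set0]_(i <- s) (if pselect (L i) then C i else set0)).
split.
- apply: bigsetU_compact => i ?; case: pselect => [Li|nLi];
    last exact: compact0.
  by have [] := CP _ Li.
- move=> x /sC[i si Cx]; rewrite /interior /= -bigcup_seq.
  apply: filterS Cx => y Cy; exists i => //=; case: pselect => // nL.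
  by have := nL (sL _ si).
- move=> x; rewrite -bigcup_seq => -[i /= si]; case: pselect => // Li Cx.
  by have [_ _] := CP _ Li; exact.
Qed.

Lemma leaf_compact (L : set M) : compact (L : set (leaf_space F)) -> compact L.
Proof.
move=> cL; pose i : leaf_space F -> M := fun x => x.
have -> : L = i @` L.
  by rewrite eqEsubset; split => [x Lx|_ [x Lx <-]] //; exists x.
apply: (@continuous_compact (leaf_space F) M i L _ cL).
apply: (@continuous_subspaceT (leaf_space F) M) => x B.
rewrite nbhsE => -[V [oV Vx] VB].
apply: (@filterS _ (nbhs (x : leaf_space F)) _ (V : set (leaf_space F)));
  first exact: VB.
apply: open_nbhs_nbhs; split=> //.
move=> phi p _ dp Vp; have : \forall q \near p, V q by apply: open_nbhs_nbhs.
by apply: filterS.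
Qed.

(** A compact leaf does not return near [q] on another plaque: the plaque [P] of [q] is open in the
    leaf topology, so the rest of the leaf is compact there, hence compact and closed in [M], and it
    misses [q]. *)
Lemma leaf_embedded p psi q : compact (leaf F p : set (leaf_space F)) ->
  F psi -> leaf F p q -> cdom psi q ->
  \forall x \near q, leaf F p x -> tcoord psi x = tcoord psi q.
Proof.
move=> cL Fpsi pq dq.
pose P := [set x : leaf_space F | cdom psi x /\ tcoord psi x = tcoord psi q].
have oP : open P.
  move=> phi x Fphi dx [dx' tx].
  have [h tc] := fol_change folF Fphi Fpsi dx dx'.
  near=> y => dy ty; split; first by near: y; exact: cdom_nbhs.
  by rewrite -tx (near tc y) // ty (nbhs_singleton tc).
have cLP : compact (leaf F p `&` ~` P : set (leaf_space F)).
  by apply: compact_closedI => //; exact: open_closedC.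
have /(compact_closed hM) clLP := leaf_compact cLP.
have : (~` (leaf F p `&` ~` P)) q by move=> [_]; apply.
move=> nq; have : \forall x \near q, (~` (leaf F p `&` ~` P)) x.
  by apply: open_nbhs_nbhs; split => //; exact: closed_openC.
apply: filterS => x nx px; apply: contrapT => ne; apply: nx; split => // -[_ e].
exact: ne.
Unshelve. all: by end_near. Qed.

Lemma saturation_nbhs (O : set M) p q : leaf F p q -> nbhs p O ->
  nbhs q [set z | exists2 x, O x & leaf F x z].
Proof.
move=> pq; elim: pq O => {p q} [x y [phi Fphi [dx dy e]] O nO|x O nO|x y z _ IH1
  _ IH2 O nO].
(* As [x] and [y] have the same last coordinate, translation by [c] moves points along plaques; it
   carries a neighbourhood of [y] into [O]. *)
- pose c := cmap phi x - cmap phi y.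
  have ct : {for y, continuous (fun z => cmap phi z + c)}.
    by apply: cvgD; [exact: (cmap_cont dy)|exact: cvg_cst].
  have n1 : \forall z \near y, O (cinv phi (cmap phi z + c)) /\
    cimg phi (cmap phi z + c).
    have n2 : \forall v \near cmap phi x, O (cinv phi v) /\ cimg phi v.
      by apply: filterS2 (near_cinv dx nO) (cimg_nbhs (cimg_cmap dx)).
    have ec : cmap phi y + c = cmap phi x by rewrite /c addrC subrK.
    by move: ct; rewrite /prop_for /continuous_at ec => /(_ _ n2).
  apply: filterS2 n1 (cdom_nbhs dy) => z [Oz cz] dz.
  exists (cinv phi (cmap phi z + c)) => //; apply: leaf_step; exists phi => //.
  split=> //; first exact: cinv_cdom.
  by rewrite {1}/tcoord (cinvK cz) !mxE -!/(tcoord _ _) e subrr addr0.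
- by apply: filterS nO => y Oy; exists y => //; exact: leaf_refl.
- apply: filterS (IH2 _ (IH1 _ nO)) => w [v [u Ou uv] vw].
  by exists u => //; exact: leaf_trans uv vw.
Qed.

(* [g] identifies the space of the leaves in [V] with the interval (-e, e), and
   the transversal [s] is a section of [g]. *)
Record is_box (V : set M) (g : M -> R) (s : R -> M) (e : R) : Prop := IsBox {
  box_gt0 : 0 < e;
  box_open : open V;
  box_leaf : forall p q, V p -> leaf F p q -> V q /\ g q = g p;
  box_lt : forall p, V p -> `|g p| < e;
  box_section : forall t, `|t| < e -> V (s t) /\ g (s t) = t;
  box_sectionK : forall p, V p -> leaf F p (s (g p));
  box_integral : forall p, V p -> first_integral_at k F g p;
  box_continuous : forall t, `|t| < e -> {for t, continuous s};
  box_local_diffeo : forall t u, `|t| < e -> first_integral_at k F u (s t) ->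
    local_diffeo k (u \o s) t;
  box_compact : forall d, d < e -> compact [set p | V p /\ `|g p| <= d] }.

Hypothesis holF : forall L, is_leaf F L -> trivial_holonomy F L.
Hypothesis cptF : forall L, is_leaf F L -> compact (L : set (leaf_space F)).

(* The germs given by transport to [phi] do not depend on any choice, so the
   finitely many local representatives needed to cover the leaf agree on it. *)
Lemma leaf_germs phi p : F phi -> cdom phi p ->
  exists f : M -> R, forall q, leaf F p q -> forall psi h,
    chain_transport F psi q phi p h ->
      \forall x \near q, f x = h (tcoord psi x).
Proof.
move=> Fphi dp; have cLs := cptF (ex_intro _ p erefl).
have cL := leaf_compact cLs.
(* Besides being compact, [C] is so small that its points on the leaf lie on the plaque of [q], so
   that one slide joins them to [q]. *)
pose loc q (psi : chart R m.+1 M) (h : R -> R) (C : set M) :=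
  [/\ chain_transport F psi q phi p h, compact C, nbhs q C &
    C `<=` [set x | cdom psi x /\ (leaf F p x -> tcoord psi x = tcoord psi q)]].
have ch q : {w : chart R m.+1 M * (R -> R) * set M | leaf F p q ->
    loc q w.1.1 w.1.2 w.2}.
  apply: cid; have [Lq|nLq] := pselect (leaf F p q);
    last by exists (phi, id, set0).
  have [psi Fpsi dq] := fol_chart folF q.
  have [h ph] := chain_exists folF (leaf_sym Lq) Fpsi dq Fphi dp.
  have nn : nbhs q [set x | cdom psi x /\ (leaf F p x ->
    tcoord psi x = tcoord psi q)].
    by apply: filterS2 (cdom_nbhs dq) (leaf_embedded cLs Fpsi Lq dq).
  by have [C [cC nC CN]] := compact_nbhs_point nn; exists (psi, h, C) => _;
    split.
pose ps q := (sval (ch q)).1.1; pose hh q := (sval (ch q)).1.2;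
  pose C q := (sval (ch q)).2.
have locP q : leaf F p q -> loc q (ps q) (hh q) (C q) by exact: svalP (ch q).
have [s [sL sC]] := compact_subcover (N := fun x => (C x)°) cL
  (fun x Lx => nbhs_interior (let: And4 _ _ h _ := locP x Lx in h)).
(* Any index whose compact set contains [x] may be selected; the default 0 is never met near the
   leaf. *)
pose f x := if pselect (exists i, i \in s /\ C i x) is left e then
  hh (sval (cid e)) (tcoord (ps (sval (cid e))) x) else 0.
exists f => q Lq psi h ph.
(* A compact set not containing [q] is avoided near [q], being closed. If [C i] contains [q],
   sliding from [q] to [i] and then following the chain of [i] competes with the given chain, and
   uniqueness of germs applies. *)
have n1 : \forall x \near q, forall i, i \in s ->
    C i x -> hh i (tcoord (ps i) x) = h (tcoord psi x).
  apply: near_all_seq => i si; have [ti cCi nCi CN] := locP i (sL i si).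
  have [Ciq|nCiq] := pselect (C i q); last first.
    have oC : open (~` C i) by apply: closed_openC; exact: compact_closed.
    by apply: filterS (open_nbhs_nbhs (conj oC nCiq)) => x nC /nC.
  have [dq tq] := CN _ Ciq; have [Fpsi _ _ _ _] := chain_spec atlasA folF ti.
  have tq' : chain_transport F (ps i) q phi p (hh i).
    have di : cdom (ps i) i by have [_] := chain_spec atlasA folF ti.
    exact: (chain_trans (chain_slide (chain_start Fpsi dq) di (esym (tq Lq)))
      ti).
  by apply: filterS (chain_germ_unique atlasA folF holF tq' ph) => x ->.
have n2 : \forall x \near q, exists i, i \in s /\ C i x.
  have [i si nq] := sC _ Lq; apply: filterS nq => x Cx; by exists i.
apply: filterS2 n1 n2 => x hx ex; rewrite /f; case: pselect => // e.
by have [is' Ci] := svalP (cid e); exact: hx.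
Qed.

End Box.

Section BoxExists.
Context {R : realType} {m : nat} {M : topologicalType}.
Variables (k : nat) (A F : set (chart R m.+1 M)).
Hypotheses (hM : hausdorff_space M) (atlasA : Cr_atlas k.+1 A)
  (folF : Cr_foliation k.+1 A F).
Hypothesis holF : forall L, is_leaf F L -> trivial_holonomy F L.
Hypothesis cptF : forall L, is_leaf F L -> compact (L : set (leaf_space F)).
Implicit Types (phi psi : chart R m.+1 M) (p q : M).
Local Notation first_integral_at := (first_integral_at k F).

Lemma local_diffeo_shift (c y : R) : local_diffeo k (fun z => z + c) y.
Proof.
split.
  exact: smooth_at_add (smooth_at_id _ _) (smooth_at_cst _ _ _).
by rewrite derive1E deriveD // derive_id derive_cst addr0 oner_neq0.
Qed.

(* Follow [f] along the segment from [p] to [z] in the plaque: the set of times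
   spent in [K] with value [f p] is open and closed. *)
Lemma first_integral_plaque f p phi z (K : set M) :
  (forall x, K x -> first_integral_at f x) -> F phi -> cdom phi p ->
    cdom phi z ->
  tcoord phi p = tcoord phi z -> closed K ->
  (forall x, K x -> f x = f p -> \forall y \near x, K y) -> K p ->
  K z /\ f z = f p.
Proof.
move=> Kf Fphi dp dz e clK oK Kp; pose c := plaque_path phi p z.
have cc : continuous c by exact: (plaque_path_cont folF Fphi dp dz).
pose S := [set s : R | K (c s) /\ f (c s) = f p].
have ST : S = setT.
  apply: (connected_clopen connected_real).
  - exists 0; rewrite /S /= /c plaque_path0 //.
  - rewrite openE => s [Ks fs]; rewrite /interior.
    have [ds ts] := plaque_path_tcoord folF s Fphi dp dz e.
    have [h lh fh] := Kf _ Ks phi Fphi ds.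
    have n1 : \forall s' \near s, f (c s') = h (tcoord phi (c s')) by exact: cc
      fh.
    have n2 : \forall s' \near s, K (c s') by exact: cc (oK _ Ks fs).
    apply: filterS2 n1 n2 => s' fs' Ks'; split=> //.
    have [ds' ts'] := plaque_path_tcoord folF s' Fphi dp dz e.
    by rewrite fs' ts' -ts -fs (nbhs_singleton fh).
  - rewrite -openC openE => s nS; rewrite /interior.
    have [Ks|nKs] := pselect (K (c s)); last first.
      have n1 : \forall s' \near s, ~ K (c s').
        apply: (cc s (~` K)); apply: open_nbhs_nbhs; split => //;
          exact: closed_openC.
      by apply: filterS n1 => s' nK [].
    have fs : f (c s) != f p by apply/eqP => fs; apply: nS.
    have cf := first_integral_cont folF (Kf _ Ks).
    have n2 : \forall s' \near s, f (c s') != f p.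
      apply: (cc s (fun y => f y != f p)); apply: (cf [set w | w != f p]).
      exact: (open_nbhs_nbhs (conj (@open_neq R (f p)) fs)).
    by apply: filterS n2 => s' /eqP ne [].
have : S 1 by rewrite ST.
by rewrite /S /= /c plaque_path1.
Qed.

(** Tube lemma for the level [y0]: a point of [K] off the level stays off all nearby levels, a point
    on it has a neighbourhood in [O], and compactness makes the width uniform. *)
Lemma tube (K O : set M) (f : M -> R) (y0 : R) : compact K ->
  (forall x, K x -> {for x, continuous f}) -> open O ->
  (forall x, K x -> f x = y0 -> O x) ->
  \forall e \near 0^'+, forall x, K x -> `|f x - y0| < e -> O x.
Proof.
move=> /compact_near_coveringP cK cf oO KO.
apply: (cK R (0 : R)^'+ (fun e x => `|f x - y0| < e -> O x)) => x Kx.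
have [fx|fx] := eqVneq (f x) y0.
  have nO : \forall y \near x, O y by apply: open_nbhs_nbhs; split=> //;
    exact: KO.
  by near=> y e => _ /=; near: y.
have d0 : 0 < `|f x - y0| by rewrite normr_gt0 subr_eq0.
have n1 : \forall y \near x, `|f x - y0| / 2 < `|f y - y0|.
  have c : {for x, continuous (fun y => `|f y - y0|)}.
    apply: (@continuous_comp _ _ _ (fun y => f y - y0));
      last exact: norm_continuous.
    by apply: cvgB; [exact: cf|exact: cvg_cst].
  apply: (c [set w | `|f x - y0| / 2 < w]); apply: open_nbhs_nbhs; split;
    first exact: open_gt.
  by rewrite /=; lra.
have n2 : \forall e \near (0 : R)^'+, e < `|f x - y0| / 2.
  by apply: nbhs_right_lt; lra.
near=> y e => /= lt; exfalso.
have h1 : `|f x - y0| / 2 < `|f y - y0| by near: y.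
have h2 : e < `|f x - y0| / 2 by near: e.
lra.
Unshelve. all: by end_near. Qed.

(* [f] extends the transport germs to a neighbourhood of the leaf L of [p0], so
   that L is the zero set of [f - y0] in a compact neighbourhood [K]; then for
   [e] small [V = K /\ |f - y0| < e] does not meet the boundary of [K], hence [V]
   is saturated, and since the leaves through the transversal [s] fill a
   neighbourhood of L, each level of [f] in [V] is a single leaf. *)
Lemma box_exists p0 : exists V g s e, is_box k F V g s e /\ (V p0 /\ g p0 = 0).
Proof.
have [phi Fphi dp] := fol_chart folF p0; set y0 := tcoord phi p0.
have [f fP] := leaf_germs hM atlasA folF holF cptF Fphi dp.
have cL : compact (leaf F p0) by apply: leaf_compact; apply: cptF; exists p0.
pose N := [set x | first_integral_at f x /\ (f x = y0 -> leaf F p0 x)].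
have fL q : leaf F p0 q -> f q = y0.
  move=> Lq; have [psi Fpsi dq] := fol_chart folF q.
  have [h ph] := chain_exists folF (leaf_sym Lq) Fpsi dq Fphi dp.
  have [_ _ _ _ [hE _]] := chain_spec atlasA folF ph.
  by rewrite (nbhs_singleton (fP q Lq _ _ ph)) hE.
have LN q : leaf F p0 q -> nbhs q N.
  move=> Lq; have [psi Fpsi dq] := fol_chart folF q.
  have [h ph] := chain_exists folF (leaf_sym Lq) Fpsi dq Fphi dp.
  have [_ _ _ _ [hE lh]] := chain_spec atlasA folF ph.
  have fh := fP q Lq _ _ ph.
  have fi := first_integral_chart atlasA folF Fpsi dq lh fh.
  (* The transport germ takes the value [y0] only at the transverse coordinate of [q]; hence the
     level [y0] of [f] is, near [q], the plaque of [q]. *)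
  have n1 : \forall x \near q, h (tcoord psi x) = h (tcoord psi q) ->
      tcoord psi x = tcoord psi q by exact: (tcoord_cont dq (local_diffeo_inj
        lh)).
  have n2 : \forall x \near q, f x = y0 -> leaf F p0 x.
    apply: filterS3 n1 fh (cdom_nbhs dq) => x n1x fx dx fxy.
    apply: (leaf_trans Lq); apply: leaf_step; exists psi => //; split=> //.
    by apply/esym/n1x; rewrite hE -/y0 -fxy.
  by apply: filterS2 (first_integral_near atlasA folF fi) n2.
have [K [cK LK KN]] := compact_nbhs_set folF cL LN.
have clK := compact_closed hM cK.
have cf x : K x -> {for x, continuous f}.
  by move=> /KN[fx _]; exact: (first_integral_cont folF fx).
have T1 := tube cK cf (@open_interior _ K) (fun x Kx fx =>
  LK _ ((KN _ Kx).2 fx)).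
pose s t := tline phi p0 (y0 + t).
pose Pd t := [/\ cimg phi (cmap phi p0 + (y0 + t - y0) *: tdir), K (s t) &
  f (s t) = y0 + t].
have nPd : \forall t \near (0 : R), Pd t.
  have n1 := tline_cimg dp.
  have n2 : \forall y \near y0, K (tline phi p0 y).
    by apply: near_tline => //; exact: LK (leaf_refl _ _).
  have n3 : \forall y \near y0, f (tline phi p0 y) = tcoord phi (tline phi p0
    y).
    apply: (near_tline (P := fun x => f x = tcoord phi x) dp).
    exact: fP (leaf_refl _ _) _ _ (chain_start Fphi dp).
  have c : (fun t => y0 + t) @ (0 : R) --> y0.
    by rewrite -[X in _ --> X]addr0; apply: cvgD;
      [exact: cvg_cst|exact: cvg_id].
  have n4 : \forall t \near (0 : R), cimg phi (cmap phi p0 + (y0 + t - y0) *: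
    tdir) /\
      (K (s t) /\ f (s t) = tcoord phi (s t)).
    exact: (c _ (filterI n1 (filterI n2 n3))).
  apply: filterS n4 => t [ci [Kt ft]].
  by split=> //; rewrite /s ft tcoord_tline.
have /nbhs_ballP[d /= d0 dP] := nPd.
have {}dP t : `|t| < d -> Pd t.
  by move=> td; apply: dP; rewrite /ball /= sub0r normrN.
pose O0 := [set x | cdom phi x /\ `|tcoord phi x - y0| < d].
pose O := [set z | exists2 x, O0 x & leaf F x z].
have oO0 x : O0 x -> nbhs x O0.
  move=> [dx tx]; have n1 : \forall y \near x, `|tcoord phi y - y0| < d.
    have c : {for x, continuous (fun y => `|tcoord phi y - y0|)}.
      apply: (@continuous_comp _ _ _ (fun y => tcoord phi y - y0));
        last exact: norm_continuous.
      by apply: cvgB; [exact: tcoord_cont|exact: cvg_cst].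
    apply: (c [set w | w < d]); apply: open_nbhs_nbhs; split=> //;
      exact: open_lt.
  by apply: filterS2 (cdom_nbhs dx) n1.
have oO : open O.
  rewrite openE => z [x Ox xz]; rewrite /interior.
  exact: saturation_nbhs xz (oO0 _ Ox).
have OL x : K x -> f x = y0 -> O x.
  move=> Kx fx; exists p0; last exact: (KN _ Kx).2.
  by split => //; rewrite -/y0 subrr normr0.
have T2 := tube cK cf oO OL.
(* The bound [e < d] keeps the section inside the chart [phi]; the first tube keeps [V] in the
   interior of [K], the second makes every leaf in [V] cross the transversal. *)
have [e [e0 ed eT1 eT2]] : exists e, [/\ 0 < e, e < d,
    forall x, K x -> `|f x - y0| < e -> (K° : set M) x &
    forall x, K x -> `|f x - y0| < e -> O x].
  near (0 : R)^'+ => e; exists e; split.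
  - by near: e; exact: nbhs_right_gt.
  - by near: e; exact: nbhs_right_lt.
  - by near: e; exact: T1.
  - by near: e; exact: T2.
pose V := [set x | K x /\ `|f x - y0| < e].
have nV x : V x -> nbhs x V.
  move=> [Kx fx]; have n1 : \forall y \near x, `|f y - y0| < e.
    have c : {for x, continuous (fun y => `|f y - y0|)}.
      apply: (@continuous_comp _ _ _ (fun y => f y - y0));
        last exact: norm_continuous.
      by apply: cvgB; [exact: cf|exact: cvg_cst].
    apply: (c [set w | w < e]); apply: open_nbhs_nbhs; split=> //;
      exact: open_lt.
  by apply: filterS2 (eT1 x Kx fx) n1.
have Vleaf p q : V p -> leaf F p q -> V q /\ f q = f p.
  move=> Vp pq; elim: pq Vp =>
    {p q} [x z [psi Fpsi [dx dz xz]]|x|x y z _ IH1 _ IH2] //.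
    move=> Vx; have [Kx fx] := Vx.
    have [Kz fz] : K z /\ f z = f x.
      apply: (first_integral_plaque (phi := psi)) => //.
      - by move=> y /KN[].
      - move=> y Ky fy; apply: filterS (nV y _); first by move=> w [].
        by split=> //; rewrite fy.
    by split=> //; split=> //; rewrite fz.
  by move=> Vx; have [Vy fy] := IH1 Vx; have [Vz fz] := IH2 Vy; rewrite fz fy.
have sV t : `|t| < e -> V (s t) /\ f (s t) = y0 + t.
  move=> te; have [ci Kt ft] := dP t (lt_trans te ed).
  by split => //; split => //; rewrite ft addrAC subrr add0r.
have Vs p : V p -> leaf F p (s (f p - y0)).
  (* The point [x] of the leaf lies in the chart [phi]; it slides along its plaque to the
     transversal at parameter [t], and invariance of [f] identifies [t] with [f p - y0]. *)
  move=> Vp; have [x [dx tx] xp] := eT2 p Vp.1 Vp.2.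
  set t := tcoord phi x - y0 in tx.
  have [ci Kt ft] := dP t tx.
  have xs : leaf F x (s t).
    apply: leaf_step; exists phi => //; split=> //; first exact: cinv_cdom.
    by rewrite /s tcoord_tline // /t addrC subrK.
  have ps := leaf_trans (leaf_sym xp) xs.
  have [_ fs] := Vleaf _ _ Vp ps.
  by rewrite -fs ft addrAC subrr add0r.
exists V, (fun x => f x - y0), s, e; split; last first.
  have fp0 : f p0 = y0 by apply: fL; exact: leaf_refl.
  split; last by rewrite fp0 subrr.
  split; first by apply: interior_subset; apply: LK; exact: leaf_refl.
  by rewrite fp0 subrr normr0.
split=> //.
- by rewrite openE => x /nV.
- by move=> p q Vp /(Vleaf _ _ Vp)[? ->].
- by move=> p [].
- by move=> t /sV[Vt ->]; split=> //; rewrite addrAC subrr add0r.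
- move=> p [/KN[fp _] _].
  exact: (first_integral_comp (u := fun z =>
    z - y0) fp (local_diffeo_shift _ _)).
- move=> t te; have [ci _ _] := dP t (lt_trans te ed).
  have c1 : {for t, continuous (fun t => y0 + t)}.
    by apply: cvgD; [exact: cvg_cst|exact: cvg_id].
  exact: (continuous_comp c1 (tline_cont ci)).
- move=> t u te ui; have [ci _ _] := dP t (lt_trans te ed).
  have tt : tcoord phi (s t) = y0 + t by exact: tcoord_tline.
  have l1 : local_diffeo k (u \o tline phi p0) (y0 + t).
    by rewrite -tt; apply: first_integral_tline ui => //; rewrite tt.
  have -> : u \o s = (u \o tline phi p0) \o (fun z => z + y0).
    by apply/funext => z; rewrite /= /s addrC.
  by apply: local_diffeo_comp; [exact: local_diffeo_shift|rewrite addrC].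
(* As d' < e, the strict inequality defining [V] is automatic, and the set is closed in [K]. *)
- move=> d' d'e; apply: (subclosed_compact _ cK); last by move=> x [[]].
  rewrite -openC openE => x nx; rewrite /interior.
  have [Kx|nKx] := pselect (K x); last first.
    have : \forall y \near x, ~ K y.
      by apply: open_nbhs_nbhs; split => //; exact: closed_openC.
    by apply: filterS => y nK [[]].
  have fx : d' < `|f x - y0|.
    rewrite ltNge; apply/negP => h; apply: nx; split=> //; split=> //.
    exact: le_lt_trans d'e.
  have c : {for x, continuous (fun y => `|f y - y0|)}.
    apply: (@continuous_comp _ _ _ (fun y => f y - y0));
      last exact: norm_continuous.
    by apply: cvgB; [exact: cf|exact: cvg_cst].
  have : \forall y \near x, d' < `|f y - y0|.
    apply: (c [set w | d' < w]); apply: open_nbhs_nbhs; split=> //;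
      exact: open_gt.
  by apply: filterS => y h [_]; rewrite leNgt h.
Unshelve. all: by end_near. Qed.

End BoxExists.

(** * Geodesics in a one-dimensional flat leaf space *)

Section Geodesics.
Context {R : realType} {M : topologicalType} {I : Type}.
Variables (lf : M -> M -> Prop) (O : I -> set M) (x : I -> M -> R).
Hypotheses (lf_refl : forall p, lf p p)
  (lf_sym : forall p q, lf p q -> lf q p)
  (lf_trans : forall q p z, lf p q -> lf q z -> lf p z).

Implicit Types (J : set R) (E : R -> M) (t e c d : R) (p q : M) (i j : I).

Definition saturated (P : M -> Prop) : Prop := forall p q, lf p q -> P p -> P q.

(** A connected Hausdorff flat one-manifold of leaves, described upstairs in [M]: [x i] is a chart
    on the leaves in [O i], [x_section] is the continuity of its inverse for the quotient topology,
    and [x_compact] says that small closed intervals have compact preimages in [M]. *)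
Hypotheses
  (O_open : forall i, open (O i))
  (O_cover : forall p, exists i, O i p)
  (O_lf : forall i p q, O i p -> lf p q -> O i q /\ x i q = x i p)
  (x_inj : forall i p q, O i p -> O i q -> x i p = x i q -> lf p q)
  (x_cont : forall i p, O i p -> {for p, continuous (x i)})
  (x_section : forall i p (P : M -> Prop), O i p -> saturated P ->
     (\forall q \near p, P q) ->
     \forall y \near x i p, forall q, O i q -> x i q = y -> P q)
  (x_image : forall i, open (x i @` O i) /\ is_interval (x i @` O i))
  (x_change : forall i j p, O i p -> O j p -> exists e c : R,
     (e = 1 \/ e = -1) /\ \forall q \near p, x j q = e * x i q + c)
  (lf_hausdorff : forall p q, ~ lf p q -> exists B C,
     [/\ saturated B, saturated C, (\forall z \near p, B z),
         (\forall z \near q, C z) & forall z, B z -> C z -> False])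
  (x_compact : forall i p, O i p -> exists2 d : R, 0 < d &
     compact [set q | O i q /\ `|x i q - x i p| <= d])
  (M_connected : connected [set: M])
  (M_noncompact : ~ compact [set: M]).

(* [E] stands for a curve in the leaf space: only the leaf of [E t] matters, and
   [E] need not be continuous into [M]. *)
Definition unit_speed_at (E : R -> M) (t : R) i e c : Prop :=
  (e = 1 \/ e = -1) /\
  \forall t' \near t, O i (E t') /\ x i (E t') = e * t' + c.

Definition geodesic (J : set R) (E : R -> M) : Prop :=
  forall t, J t -> exists i e c, unit_speed_at E t i e c.

Lemma unit_sqr (e : R) : e = 1 \/ e = -1 -> e * e = 1.
Proof. by move=> [->|->]; rewrite ?mulr1 ?mulrNN ?mulr1. Qed.

Lemma affine_cont (e c t : R) : (fun s => e * s + c) @ t --> e * t + c.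
Proof.
apply: cvgD; last exact: cvg_cst.
by apply: cvgM; [exact: cvg_cst|exact: cvg_id].
Qed.

Lemma unit_speed_lf E E' t i e c : (\forall t' \near t, lf (E t') (E' t')) ->
  unit_speed_at E t i e c -> unit_speed_at E' t i e c.
Proof.
move=> EE' [e1 nE]; split=> //; apply: filterS2 EE' nE => t' l [ Oi xi].
by have [ Oi' xi'] := O_lf Oi l; rewrite xi'.
Qed.

(** Continuity of [E] as a curve of leaves, tested on saturated neighbourhoods. *)
Lemma unit_speed_saturated E t i e c (P : M ->
  Prop) : unit_speed_at E t i e c ->
  saturated P -> (\forall q \near E t, P q) -> \forall t' \near t, P (E t').
Proof.
move=> [_ nE] sP nP; have [ Oi xi] := nbhs_singleton nE.
have n1 := x_section Oi sP nP; rewrite xi in n1.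
have n2 : \forall t' \near t, forall q, O i q -> x i q = e * t' + c -> P q.
  exact: (@affine_cont e c t _ n1).
by apply: filterS2 n2 nE => t' h [ O1 x1]; exact: h.
Qed.

Lemma unit_speed_change E t i e c j : unit_speed_at E t i e c -> O j (E t) ->
  exists e' c', unit_speed_at E t j e' c'.
Proof.
move=> us Oj; have [se nE] := us; have [ Oi xi] := nbhs_singleton nE.
have [e1 [c1 [se1 nx]]] := x_change Oi Oj.
(* The change of charts is known near [E t] in [M]; stated as a saturated predicate, it passes to
   [E t'] for nearby times. *)
pose P q := [/\ O i q, O j q & x j q = e1 * x i q + c1].
have sP : saturated P.
  move=> p q pq [ O1 O2 x12]; have [ O1' x1'] := O_lf O1 pq.
  by have [ O2' x2'] := O_lf O2 pq; split=> //; rewrite x1' x2'.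
have nP : \forall q \near E t, P q.
  have n1 : \forall q \near E t, O i q by apply: open_nbhs_nbhs.
  have n2 : \forall q \near E t, O j q by apply: open_nbhs_nbhs.
  by apply: filterS3 n1 n2 nx => q.
exists (e1 * e), (e1 * c + c1); split.
  by case: se1 => ->; case: se => ->; rewrite ?mulrNN ?mulr1 ?mul1r;
    [left|right|right|left].
apply: filterS2 (unit_speed_saturated us sP nP) nE => t' [_ Oj' ->] [_ ->].
by split=> //; ring.
Qed.

Lemma affine_unique (t e c e' c' : R) :
  (\forall s \near t, e * s + c = e' * s + c') -> e = e' /\ c = c'.
Proof.
move=> /nbhs_ballP[d /= d0 h].
have h1 : e * t + c = e' * t + c' by apply: h; exact: ballxx.
have h2 : e * (t + d / 2) + c = e' * (t + d / 2) + c'.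
  by apply: h; rewrite /ball /= opprD addrA subrr sub0r normrN gtr0_norm; lra.
have ee : e = e'.
  have : (e - e') * (d / 2) = 0 by nra.
  by move/eqP; rewrite mulf_eq0 => /orP[/eqP|/eqP]; lra.
by split=> //; subst e'; lra.
Qed.

(** The times near which the curves agree form an open set. At a limit time the two leaves coincide
    by the Hausdorff property; in a common chart both curves are affine and agree on some nearby
    interval, so slope and constant are equal. *)
Lemma geodesic_unique J E E' t0 : is_interval J -> geodesic J E ->
  geodesic J E' ->
  J t0 -> (\forall t \near t0, lf (E t) (E' t)) -> forall t, J t ->
    lf (E t) (E' t).
Proof.
move=> iJ gE gE' Jt0 n0.
pose C := [set t : R | \forall t' \near t, lf (E t') (E' t')].
have oC : open C by rewrite openE => t Ct; rewrite /interior;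
  exact: near_join Ct.
suff JC : J `&` C = J by move=> t; rewrite -JC => -[_ /nbhs_singleton].
move/connected_intervalP : iJ => cJ; apply: cJ.
- by exists t0.
- by exists C.
exists (closure C); first exact: closed_closure.
rewrite eqEsubset; split=> [t [Jt Ct]|t [Jt Ct]]; first by split=> //;
  exact: subset_closure.
split=> //.
have [i [e [c us]]] := gE _ Jt; have [i' [e' [c' us']]] := gE' _ Jt.
have lt : lf (E t) (E' t).
  apply: contrapT => nl; have [B [D [sB sD nB nD BD]]] := lf_hausdorff nl.
  have := Ct _ (filterI (unit_speed_saturated us sB nB) (unit_speed_saturated
    us' sD nD)).
  move=> [t' [Ct' [Bt' Dt']]]; apply: (BD (E' t')) => //.
  exact: sB (nbhs_singleton Ct') Bt'.
have [se nE] := us; have [ Oi xi] := nbhs_singleton nE.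
have [ Oi' _] := O_lf Oi lt.
have [e2 [c2 [se2 nE2]]] := unit_speed_change us' Oi'.
have [ee cc] : e = e2 /\ c = c2.
  have [t1 [Ct1 [n1 n2]]] := Ct _ (filterI (near_join nE) (near_join nE2)).
  apply: (@affine_unique t1);
    apply: filterS3 Ct1 n1 n2 => s l [ O1 x1] [ O2 x2].
  by rewrite -x1 -x2; have [_ ->] := O_lf O1 l.
apply: filterS2 nE nE2 => s [ O1 x1] [ O2 x2].
by apply: (x_inj O1 O2); rewrite x1 x2 ee cc.
Qed.

Lemma geodesic_sub J J' E : J' `<=` J -> geodesic J E -> geodesic J' E.
Proof. by move=> sJ gE t /sJ; exact: gE. Qed.

Lemma is_intervalI (J J' : set R) : is_interval J -> is_interval J' ->
  is_interval (J `&` J').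
Proof.
move=> iJ iJ' a b [Ja Ja'] [Jb Jb'] c ab; split; first exact: iJ ab.
exact: iJ' ab.
Qed.

Lemma is_intervalU (J J' : set R) t : is_interval J -> is_interval J' ->
  J t -> J' t -> is_interval (J `|` J').
Proof.
move=> iJ iJ' Jt J't; apply/connected_intervalP; apply: connectedU => //.
- by exists t.
- exact/connected_intervalP.
- exact/connected_intervalP.
Qed.

Lemma geodesic_glue J J' E E' t0 : open J -> open J' -> is_interval J ->
  is_interval J' -> geodesic J E -> geodesic J' E' -> J t0 -> J' t0 ->
  (\forall t \near t0, lf (E t) (E' t)) ->
  exists E'', [/\ geodesic (J `|` J') E'', forall t, J t -> E'' t = E t &
    forall t, J' t -> lf (E'' t) (E' t)].
Proof.
move=> oJ oJ' iJ iJ' gE gE' Jt J't n0.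
have u := geodesic_unique (is_intervalI iJ iJ')
  (geodesic_sub (@subIsetl _ _ _) gE) (geodesic_sub (@subIsetr _ _ _) gE')
  (conj Jt J't) n0.
pose E2 t := if pselect (J t) then E t else E' t.
have E2J t : J t -> E2 t = E t by move=> h; rewrite /E2; case: pselect.
have E2J' t : J' t -> lf (E2 t) (E' t).
  by move=> h; rewrite /E2; case: pselect => // h'; exact: u.
exists E2; split=> // t [Jt'|J't'].
- have [i [e [c us]]] := gE _ Jt'; exists i, e, c; apply: unit_speed_lf us.
  have : \forall t' \near t, J t' by apply: open_nbhs_nbhs.
  by apply: filterS => t' /E2J ->.
- have [i [e [c us]]] := gE' _ J't'; exists i, e, c; apply: unit_speed_lf us.
  have : \forall t' \near t, J' t' by apply: open_nbhs_nbhs.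
  by apply: filterS => t' /E2J' /lf_sym.
Qed.

(** The inverse of the chart [x i], with a representative chosen on each leaf and reparametrized to
    pass through [p] at time [t0] with slope [e]; it sweeps the whole of [O i]. *)
Lemma chart_geodesic i p (e t0 : R) : O i p -> e = 1 \/ e = -1 ->
  exists J E, [/\ open J, is_interval J, geodesic J E &
    forall q, O i q -> J (t0 + e * (x i q - x i p)) /\
      lf (E (t0 + e * (x i q - x i p))) q] /\
    (forall t, J t -> O i (E t) /\ x i (E t) = e * (t - t0) + x i p).
Proof.
move=> Oi se; have ee := unit_sqr se; have [ oX iX] := x_image i.
pose a t := e * (t - t0) + x i p.
have aE t : a t = e * t + (x i p - e * t0) by rewrite /a; ring.
have ca : continuous a.
  move=> t; rewrite (_ : a = fun t => e * t + (x i p - e * t0));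
    last exact/funext.
  exact: affine_cont.
pose J := a @^-1` (x i @` O i).
have ch t : {q | J t -> O i q /\ x i q = a t}.
  apply: cid; have [[q Oq xq]|nJ] := pselect (J t); last by exists p.
  by exists q.
pose E t := sval (ch t); have EP t : J t -> O i (E t) /\ x i (E t) = a t.
  exact: svalP (ch t).
have oJ : open J by apply: open_comp => // t _; exact: ca.
exists J, E; split; last exact: EP.
split=> //.
- move=> b c Jb Jc d /andP[bd dc].
  case: se => se; rewrite /J /= /a se.
    apply: (iX _ _ Jb Jc); rewrite /a se; apply/andP; split; lra.
  apply: (iX _ _ Jc Jb); rewrite /a se; apply/andP; split; lra.
- move=> t Jt; exists i, e, (x i p - e * t0); split => //.
  have : \forall t' \near t, J t' by apply: open_nbhs_nbhs.
  by apply: filterS => t' /EP; rewrite aE.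
- move=> q Oq; have aq : a (t0 + e * (x i q - x i p)) = x i q.
    by rewrite /a addrAC subrr add0r mulrA ee mul1r subrK.
  have Jq : J (t0 + e * (x i q - x i p)) by rewrite /J /= aq; exists q.
  split=> //; have [ O1 x1] := EP _ Jq.
  by apply: (x_inj O1 Oq); rewrite x1 aq.
Qed.

(** * The exponential map of a germ of geodesic *)

Section Exponential.
Variable E0 : R -> M.

Definition admissible J E : Prop :=
  [/\ open J, is_interval J, geodesic J E, J 0 &
    \forall t \near (0 : R), lf (E0 t) (E t)].

(** The exponential map as a relation, taken over all geodesic extensions of the germ [E0]: no
    maximal extension has to be constructed. *)
Definition reaches (t : R) (p : M) : Prop :=
  exists J E, [/\ admissible J E, J t & lf (E t) p].

Lemma admissible_glue J E J' E' t : admissible J E -> open J' ->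
  is_interval J' ->
  geodesic J' E' -> J t -> J' t -> (\forall s \near t, lf (E s) (E' s)) ->
  exists E2, admissible (J `|` J') E2 /\ forall s, J' s -> lf (E2 s) (E' s).
Proof.
move=> [ oJ iJ gE J0 n] oJ' iJ' gE' Jt J't nt.
have [E2 [g2 e2 l2]] := geodesic_glue oJ oJ' iJ iJ' gE gE' Jt J't nt.
exists E2; split=> //; split=> //.
- exact: openU.
- exact: is_intervalU Jt J't.
- by left.
- have nJ : \forall s \near (0 : R), J s by apply: open_nbhs_nbhs.
  by apply: filterS2 n nJ => s h /e2 ->.
Qed.

(** Once a geodesic enters a chart, gluing it to the inverse of the chart extends it over all of
    [O i], at the times prescribed by the same affine law. *)
Lemma reaches_chart J E t i e c : admissible J E -> J t ->
  unit_speed_at E t i e c ->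
  forall q, O i q -> reaches (e * (x i q - c)) q.
Proof.
move=> aJE Jt us q Oq; have [se nE] := us; have [ Oi xi] := nbhs_singleton nE.
have ee := unit_sqr se.
have [J' [E' [[ oJ' iJ' gE' h1] h2]]] := chart_geodesic t Oi se.
have J't : J' t by have [] := h1 _ Oi; rewrite subrr mulr0 addr0.
have nEE' : \forall s \near t, lf (E s) (E' s).
  have nJ' : \forall s \near t, J' s by apply: open_nbhs_nbhs.
  apply: filterS2 nE nJ' => s [ O1 x1] /h2[ O2 x2]; apply: (x_inj O1 O2).
  by rewrite x1 x2 xi; ring.
have [E2 [a2 l2]] := admissible_glue aJE oJ' iJ' gE' Jt J't nEE'.
have [Jq lq] := h1 _ Oq.
have tE : e * (x i q - c) = t + e * (x i q - x i (E t)).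
  by rewrite xi !mulrBr mulrDr mulrA ee mul1r; ring.
rewrite tE; exists (J `|` J'), E2; split=> //; first by right.
exact: lf_trans (l2 _ Jq) lq.
Qed.

Lemma reaches_local t p : reaches t p -> exists i e c,
  [/\ (e = 1 \/ e = -1), O i p, x i p = e * t + c & forall q, O i q ->
    reaches (e * (x i q - c)) q].
Proof.
move=> [J [E [aJE Jt lp]]]; have [_ _ gE _ _] := aJE.
have [i [e [c us]]] := gE _ Jt; have [se nE] := us.
have [ Oi xi] := nbhs_singleton nE; have [ Oi' xi'] := O_lf Oi lp.
exists i, e, c; split=> //; first by rewrite xi'.
exact: (reaches_chart aJE Jt us).
Qed.

(** The set of points reached is open by [reaches_local]. A chart around a limit point contains a
    point already reached, so it is reached entirely. *)
Lemma reaches_onto p0 : reaches 0 p0 -> forall p, exists t, reaches t p.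
Proof.
move=> r0; pose S := [set p | exists t, reaches t p].
suff ST : S = setT by move=> p; have : S p by rewrite ST.
apply: connected_clopen => //; first by exists p0, 0.
- rewrite openE => p [t /reaches_local[i [e [c [_ Oi _ h]]]]];
    rewrite /interior.
  have : \forall q \near p, O i q by apply: open_nbhs_nbhs.
  by apply: filterS => q /h; exists (e * (x i q - c)).
- move=> p Sp; have [i Oi] := O_cover p.
  have [q [[t [J [E [aJE Jt lq]]]] Oq]] :=
    Sp (O i) (open_nbhs_nbhs (conj (O_open i) Oi)).
  have [_ _ gE _ _] := aJE; have [j [e [c us]]] := gE _ Jt.
  have [ Oi' _] := O_lf Oq (lf_sym lq).
  have [e' [c' us']] := unit_speed_change us Oi'.
  by exists (e' * (x i p - c')); exact: (reaches_chart aJE Jt us' Oi).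
Qed.

(* The geodesic closes up at [t2] with its direction at [t1], so the leaves it
   meets on [t1, t2] form an open set; it is closed by compactness. *)
Lemma closed_loop_compact J E t1 t2 i e c1 c2 : geodesic J E -> is_interval J ->
  J t1 -> J t2 -> t1 < t2 ->
  unit_speed_at E t1 i e c1 -> unit_speed_at E t2 i e c2 -> lf (E t1) (E t2) ->
    False.
Proof.
move=> gE iJ J1 J2 t12 us1 us2 l12.
have [se n1] := us1; have [_ n2] := us2; have ee := unit_sqr se.
have [ O1 x1] := nbhs_singleton n1; have [ O2 x2] := nbhs_singleton n2.
have c12 : e * t1 + c1 = e * t2 + c2.
  by rewrite -x1 -x2; have [_ ->] := O_lf O1 l12.
pose S := [set p | exists2 t, t1 <= t <= t2 & lf (E t) p].
have Jt t : t1 <= t <= t2 -> J t by move=> h; exact: (iJ _ _ J1 J2).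
have cS : compact [set` `[t1, t2]] by exact: segment_compact.
(* At the common leaf of the two ends, half of a neighbourhood is swept just after [t1]. The other
   half, met just before [t1], is also swept just before [t2], since by [c12] the two affine laws
   differ by the shift [t2 - t1]. *)
have near_end p : lf (E t1) p -> \forall q \near p, S q.
  move=> l1; have [ O1p x1p] := O_lf O1 l1.
  have cx : {for p, continuous (fun q => e * (x i q - c1))}.
    apply: cvgM; first exact: cvg_cst.
    by apply: cvgB; [exact: x_cont|exact: cvg_cst].
  have tp : e * (x i p - c1) = t1 by rewrite x1p x1 addrK mulrA ee mul1r.
  have m1 : \forall q \near p, O i (E (e * (x i q - c1))) /\
      x i (E (e * (x i q - c1))) = e * (e * (x i q - c1)) + c1.
    by apply: (cx (fun s => O i (E s) /\ x i (E s) = e * s + c1)); rewrite tp.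
  have m2 : \forall q \near p, O i (E (e * (x i q - c1) + (t2 - t1))) /\
      x i (E (e * (x i q - c1) + (t2 - t1))) = e * (e * (x i q - c1) + (t2 -
        t1)) + c2.
    have cx2 : {for p, continuous (fun q => e * (x i q - c1) + (t2 - t1))}.
      by apply: cvgD; [exact: cx|exact: cvg_cst].
    apply: (cx2 (fun s => O i (E s) /\ x i (E s) = e * s + c2)).
    by rewrite tp addrC subrK.
  have m3 : \forall q \near p, `|e * (x i q - c1) - t1| < t2 - t1.
    have cx3 : {for p, continuous (fun q => `|e * (x i q - c1) - t1|)}.
      apply: (@continuous_comp _ _ _ (fun q => e * (x i q - c1) - t1));
        last exact: norm_continuous.
      by apply: cvgB; [exact: cx|exact: cvg_cst].
    apply: (cx3 [set w | w < t2 - t1]); apply: open_nbhs_nbhs; split;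
      first exact: open_lt.
    by rewrite /= tp subrr normr0 subr_gt0.
  have m4 : \forall q \near p, O i q by apply: open_nbhs_nbhs.
  apply: filterS3 (filterI m1 m2) m3 m4 => q [[ Oa xa] [ Ob xb]].
  rewrite ltr_norml => /andP[lo hi] Oq.
  have [ge|lt] := leP t1 (e * (x i q - c1)).
    exists (e * (x i q - c1)); first by apply/andP; split; lra.
    by apply: (x_inj Oa Oq); rewrite xa mulrA ee mul1r subrK.
  exists (e * (x i q - c1) + (t2 - t1)); first by apply/andP; split; lra.
  apply: (x_inj Ob Oq); rewrite xb mulrDr mulrA ee mul1r mulrBr; lra.
have SO : open S.
  rewrite openE => p [t /andP[ta tb] lp]; rewrite /interior.
  have [ea|na] := eqVneq t t1; first by apply: near_end; rewrite -ea.
  have [eb|nb] := eqVneq t t2; first by apply: near_end; rewrite eb in lp;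
    exact: lf_trans lp.
  have ti : t1 < t < t2 by rewrite !lt_neqAle ta tb nb eq_sym na.
  have tJ : J t by apply: Jt; rewrite ta tb.
  have [j [e' [c' [se' nE']]]] := gE _ tJ; have ee' := unit_sqr se'.
  have [ Oj xj] := nbhs_singleton nE'; have [ Ojp xjp] := O_lf Oj lp.
  have cx : {for p, continuous (fun q => e' * (x j q - c'))}.
    apply: cvgM; first exact: cvg_cst.
    by apply: cvgB; [exact: x_cont|exact: cvg_cst].
  have tp : e' * (x j p - c') = t by rewrite xjp xj addrK mulrA ee' mul1r.
  have m1 : \forall q \near p, (O j (E (e' * (x j q - c'))) /\
      x j (E (e' * (x j q - c'))) = e' * (e' * (x j q - c')) + c') /\
      t1 < e' * (x j q - c') < t2.
    apply: (cx (fun s => (O j (E s) /\ x j (E s) = e' * s + c') /\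
      t1 < s < t2)).
    rewrite tp; apply: filterS2 nE' _; last first.
      by apply: filterI; [exact: (lt_nbhsr (proj1 (andP ti)))|exact: (lt_nbhsl
        (proj2 (andP ti)))].
    by move=> s h [h1 h2]; split=> //; rewrite h1 h2.
  have m4 : \forall q \near p, O j q by apply: open_nbhs_nbhs.
  apply: filterS2 m1 m4 => q [[ Oa xa] /andP[lo hi]] Oq.
  exists (e' * (x j q - c')); first by rewrite !ltW.
  by apply: (x_inj Oa Oq); rewrite xa mulrA ee' mul1r subrK.
have SC : closed S.
  rewrite -openC openE => p nS; rewrite /interior.
  have cov := (compact_near_coveringP _).1 cS.
  (* Each leaf [E t] is separated from [p]; compactness of [t1, t2] gives one neighbourhood of [p]
     that works for all these times. *)
  have h : \forall q \near p, [set` `[t1, t2]] `<=` (fun t => ~ lf (E t) q).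
    apply: (cov M (nbhs p) (fun q t => ~ lf (E t) q)) => t;
      rewrite /= in_itv /= => th.
    have nl : ~ lf (E t) p by move=> l; apply: nS; exists t.
    have [B [D [sB sD nB nD BD]]] := lf_hausdorff nl.
    have [j [e' [c' us]]] := gE _ (Jt _ th).
    have nB' := unit_speed_saturated us sB nB.
    exists ([set s | B (E s)], D) => // -[s q] /= [Bs Dq] l.
    by apply: (BD q) => //; exact: sB l Bs.
  apply: filterS h => q h [t th lq].
  by apply: (h t) => //; rewrite /= in_itv.
have ST : S = setT.
  by apply: connected_clopen => //; exists (E t1), t1 => //; rewrite lexx ltW.
apply: M_noncompact.
(* The leaves met near a given time lie in one compact set. Finitely many such sets serve all of
   [t1, t2], and they cover [M] because [S] is everything. *)
have chc t : {C | t1 <= t <= t2 -> compact C /\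
    \forall s \near t, forall q, lf (E s) q -> C q}.
  apply: cid; have [th|nth] := pselect (t1 <= t <= t2); last by exists set0.
  have [j [e' [c' us]]] := gE _ (Jt _ th).
  have [ Oj xj] := nbhs_singleton us.2.
  have [d d0 cd] := x_compact Oj.
  exists [set q | O j q /\ `|x j q - x j (E t)| <= d] => _; split=> //.
  have sP : saturated (fun q => O j q /\ `|x j q - x j (E t)| <= d).
    by move=> p q l [ Op xp]; have [ Oq ->] := O_lf Op l.
  have nP : \forall q \near E t, O j q /\ `|x j q - x j (E t)| <= d.
    have m4 : \forall q \near E t, O j q by apply: open_nbhs_nbhs.
    have m5 : \forall q \near E t, `|x j q - x j (E t)| <= d.
      have := x_cont Oj => /cvgrPdist_le /(_ _ d0); apply: filterS => q.
      by rewrite distrC.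
    by apply: filterS2 m4 m5.
  by apply: filterS (unit_speed_saturated us sP nP) => s h q l; exact: sP l h.
pose C t := sval (chc t).
have CP t : t1 <= t <= t2 -> compact (C t) /\
    \forall s \near t, forall q, lf (E s) q -> C t q by exact: svalP (chc t).
have [|l [lK lC]] := compact_subcover (N := fun t =>
  [set s | forall q, lf (E s) q -> C t q]) cS.
  by move=> t; rewrite /= in_itv /= => /CP[].
rewrite (_ : setT = \big[setU/set0]_(t <- l) (if pselect (t1 <= t <= t2) then C
  t else set0)).
  apply: bigsetU_compact => t ?; case: pselect => [th|nth];
    last exact: compact0.
  by have [] := CP _ th.
rewrite eqEsubset; split=> // p _; have [t th lp] : S p by rewrite ST.
have [t' t'l h] : exists2 t', t' \in l & forall q, lf (E t) q -> C t' q.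
  by apply: lC; rewrite /= in_itv.
rewrite -bigcup_seq; exists t' => //=; case: pselect => [th'|nth'];
  first exact: h.
by case: nth'; have := lK _ t'l; rewrite /= in_itv.
Qed.

(* If the directions at [t1] and [t2] agree then [M] is compact; otherwise [E]
   is symmetric about the midpoint, near which it is injective. *)
Lemma reaches_inj t1 t2 p : reaches t1 p -> reaches t2 p -> t1 < t2 -> False.
Proof.
move=> [J1 [E1 [a1 J1t l1]]] [J2 [E2 [a2 J2t l2]]] t12.
have [ oJ1 iJ1 gE1 J10 n1] := a1; have [ oJ2 iJ2 gE2 J20 n2] := a2.
have n12 : \forall s \near (0 : R), lf (E1 s) (E2 s).
  by apply: filterS2 n1 n2 => s h h'; exact: lf_trans (lf_sym h) h'.
have [E [gE e1 e2]] := geodesic_glue oJ1 oJ2 iJ1 iJ2 gE1 gE2 J10 J20 n12.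
set J := J1 `|` J2 in gE.
have iJ : is_interval J by exact: is_intervalU J10 J20.
have Jt1 : J t1 by left.
have Jt2 : J t2 by right.
have lE : lf (E t1) (E t2).
  rewrite e1 //; apply: lf_trans l1 _; apply: lf_sym.
  exact: lf_trans (e2 _ J2t) l2.
have [i [e [c us]]] := gE _ Jt1; have [se nE] := us;
  have [ Oi xi] := nbhs_singleton nE.
have [ Oi' xi'] := O_lf Oi lE.
have [i' [e' [c' us']]] := gE _ Jt2.
have [e2' [c2 us2]] := unit_speed_change us' Oi'.
have [se2 nE2] := us2; have [_ xi2] := nbhs_singleton nE2.
have [ee|ne] := eqVneq e e2'.
  by rewrite -ee in us2; exact: (closed_loop_compact gE iJ Jt1 Jt2 t12 us us2
    lE).
have {ne} ne : e2' = - e.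
  by case: se ne => ->; case: se2 => -> ; rewrite ?eqxx ?opprK.
(* With opposite directions at [t1] and [t2], the reflected curve passes through the same leaf as
   [E] at [t1] with the same slope. *)
pose Es t := E (t1 + t2 - t); pose Js := [set t | J (t1 + t2 - t)].
have rc (t : R) : (fun s => t1 + t2 - s) @ t --> t1 + t2 - t.
  by apply: cvgB; [exact: cvg_cst|exact: cvg_id].
have gEs : geodesic Js Es.
  move=> t /gE[j [f [d [sf nf]]]]; exists j, (- f), (f * (t1 + t2) + d); split.
    by case: sf => ->; rewrite ?opprK; [right|left].
  have nf' : \forall s \near t, O j (Es s) /\
    x j (Es s) = f * (t1 + t2 - s) + d.
    exact: (rc t _ nf).
  by apply: filterS nf' => s [ Oj ->]; split=> //; ring.
have iJs : is_interval Js.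
  move=> a b Ja Jb d /andP[ad db]; apply: (iJ _ _ Jb Ja); apply/andP; split;
    lra.
have nEs : \forall t \near t1, lf (E t) (Es t).
  have n3 : \forall t \near t1, O i (Es t) /\
    x i (Es t) = e2' * (t1 + t2 - t) + c2.
    apply: (rc t1 (fun s => O i (E s) /\ x i (E s) = e2' * s + c2)).
    by rewrite addrAC subrr add0r.
  apply: filterS2 nE n3 => t [ Oa xa] [ Ob xb]; apply: (x_inj Oa Ob).
  rewrite xa xb ne; have := xi'; rewrite xi xi2 ne; lra.
pose u := (t1 + t2) / 2.
have Ju : J u by apply: (iJ _ _ Jt1 Jt2); apply/andP; split; rewrite /u; lra.
have [j [f [d [sf nf]]]] := gE _ Ju.
have n4 : \forall t \near u, O j (Es t) /\ x j (Es t) = f * (t1 + t2 - t) + d.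
  apply: (rc u (fun s => O j (E s) /\ x j (E s) = f * s + d)).
  by rewrite (_ : t1 + t2 - u = u) // /u; field.
have := geodesic_unique (is_intervalI iJ iJs) (geodesic_sub (@subIsetl _ _ _)
  gE)
  (geodesic_sub (@subIsetr _ _ _) gEs) (t0 := t1) _ nEs.
have Js1 : Js t1 by rewrite /Js /= addrAC subrr add0r.
move=> /(_ (conj Jt1 Js1)) uE.
have oJ : open J by exact: openU.
have nJ : \forall t \near u, J t by apply: open_nbhs_nbhs.
have nJs : \forall t \near u, J (t1 + t2 - t).
  by apply: (rc u J); rewrite (_ : t1 + t2 - u = u) // /u; field.
(* In one chart at the midpoint, [E] has slope [f] and its reflection has slope [-f]; agreement
   contradicts unit speed. *)
have n5 : \forall t \near u, f * t + d = - f * t + (f * (t1 + t2) + d).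
  apply: filterS3 (filterI nf n4) nJ nJs => t [[ Oa xa] [ Ob xb]] Ja Jb.
  have [_ e3] := O_lf Oa (uE t (conj Ja Jb)).
  by rewrite -xa -e3 xb; ring.
have [ff _] := affine_unique n5.
by case: sf ff => ->; lra.
Qed.

End Exponential.

(** The value [f p] is the time at which the leaf of [p] is reached, unique by [reaches_inj]; near
    [p] the affine law of [reaches_local] computes it. *)
Lemma global_coordinate (p0 : M) : exists f : M -> R, forall p, exists i e c,
  [/\ (e = 1 \/ e = -1), O i p & \forall q \near p, f q = e * (x i q - c)].
Proof.
have [i0 Oi0] := O_cover p0.
have [J [E [[ oJ iJ gE h1] _]]] := chart_geodesic 0 Oi0 (or_introl erefl).
have [] := h1 _ Oi0; rewrite subrr mulr0 addr0 => J0 lE0.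
have aJ : admissible E J E by split=> //; near=> t; exact: lf_refl.
have r0 : reaches E 0 p0 by exists J, E.
have ch p : {t | reaches E t p} by apply: cid; exact: reaches_onto r0 p.
exists (fun p => sval (ch p)) => p.
have [i [e [c [se Oi _ h]]]] := reaches_local (svalP (ch p)).
exists i, e, c; split=> //.
have : \forall q \near p, O i q by apply: open_nbhs_nbhs.
apply: filterS => q /h rq; have rq' := svalP (ch q).
case: (ltgtP (sval (ch q)) (e * (x i q - c))) => // lt.
  by case: (reaches_inj rq' rq lt).
by case: (reaches_inj rq rq' lt).
Unshelve. all: by end_near. Qed.

End Geodesics.

(** * A density on the leaf space *)

Lemma mean_value {R : realType} (F h : R -> R) (a d s t : R) :
  (forall z, `|z - a| < d -> deriv F z (h z)) -> `|s - a| < d -> `|t - a| < d ->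
  s <= t -> exists2 c, `|c - a| < d & F t - F s = h c * (t - s).
Proof.
move=> dF; rewrite !ltr_norml => /andP[s1 s2] /andP[t1 t2] st.
have inb z : s <= z -> z <= t -> `|z - a| < d.
  by move=> sz zt; rewrite ltr_norml; apply/andP; split; lra.
have [|z|c] := @MVT_segment R F h s t st.
- move=> z; rewrite in_itv /= => /andP[sz zt].
  by apply: dF; apply: inb; exact: ltW.
- apply: continuous_in_subspaceT => w; rewrite inE /= in_itv /= => /andP[sw wt].
  apply: differentiable_continuous; apply/derivable1_diffP.
  by have [] := dF w (inb w sw wt).
- by rewrite in_itv /= => /andP[sc ct] E; exists c => //; exact: inb.
Qed.

Section Density.
Context {R : realType} {m : nat} {M : topologicalType}.
Variables (k : nat) (A F : set (chart R m.+1 M)).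
Hypotheses (hM : hausdorff_space M) (atlasA : Cr_atlas k.+1 A)
  (folF : Cr_foliation k.+1 A F).
Variables (V : nat -> set M) (g : nat -> M -> R) (s : nat -> R -> M) (e : nat ->
  R).
Hypothesis bx : forall n, is_box k F (V n) (g n) (s n) (e n).
Hypothesis core_cover : forall p, exists n, V n p /\ `|g n p| < e n / 2.
Implicit Types (p q : M) (i j l n N : nat) (t y : R).
Local Notation lf := (leaf F).
Local Notation first_integral_at := (first_integral_at k F).

Let e0 i : 0 < e i. Proof. exact: box_gt0 (bx i). Qed.
Let Vlf i p q : V i p -> lf p q -> V i q /\ g i q = g i p.
Proof. exact: (box_leaf (bx i)). Qed.
Let Vs i t : `|t| < e i ->
  V i (s i t). Proof. by case/(box_section (bx i)). Qed.
Let gs i t : `|t| < e i ->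
  g i (s i t) = t. Proof. by case/(box_section (bx i)). Qed.
Let sg i p : V i p -> lf p (s i (g i p)). Proof. exact: (box_sectionK (bx i)).
  Qed.
Let gi i p : V i p -> first_integral_at (g i) p. Proof. exact: (box_integral (bx
  i)). Qed.
Let gc i p : V i p -> {for p, continuous (g i)}.
Proof. by move=> Vp; exact: (first_integral_cont folF (gi Vp)). Qed.
Let sc i t : `|t| < e i -> {for t, continuous (s i)}.
Proof. exact: (box_continuous (bx i)). Qed.

Lemma near_lt (a b t : R) : `|t - a| < b -> \forall z \near t, `|z - a| < b.
Proof.
move=> ta; have c : {for t, continuous (fun z => `|z - a|)}.
  apply: (@continuous_comp _ _ _ (fun z => z - a)); last exact: norm_continuous.
  by apply: cvgB; [exact: cvg_id|exact: cvg_cst].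
apply: (c [set w | w < b]); apply: open_nbhs_nbhs; split=> //; exact: open_lt.
Qed.

Lemma near_lt0 (b t : R) : `|t| < b -> \forall z \near t, `|z| < b.
Proof.
move=> tb; have := @near_lt 0 b t; rewrite subr0 => /(_ tb).
by apply: filterS => z; rewrite subr0.
Qed.

Lemma near_V i j t : `|t| < e i -> V j (s i t) ->
  \forall z \near t, V j (s i z).
Proof.
move=> te Vj; apply: (sc te); apply: open_nbhs_nbhs; split=> //;
  exact: (box_open (bx j)).
Qed.

Lemma core_closed i d : d < e i -> closed [set p | V i p /\ `|g i p| <= d].
Proof. by move=> de; apply: compact_closed => //;
  exact: (box_compact (bx i)). Qed.

Lemma local_diffeo_transition i j t : `|t| < e i -> V j (s i t) ->
  local_diffeo k (g j \o s i) t.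
Proof. by move=> te Vj; apply: (box_local_diffeo (bx i)) => //; exact: gi. Qed.

(** The factor 2 / e puts the support in [|g j| <= e j / 2], a compact part of the box and hence
    closed in [M]: this is what makes the extension by zero regular. *)
Definition bump j p : R :=
  if pselect (V j p) then pospow k (1 - (2 / e j * g j p) ^+ 2) else 0.

Lemma bumpE j p : V j p -> bump j p = pospow k (1 - (2 / e j * g j p) ^+ 2).
Proof. by rewrite /bump; case: pselect. Qed.

Lemma bump_lf j p q : lf p q -> bump j q = bump j p.
Proof.
move=> pq; rewrite /bump; case: pselect => [Vq|nVq];
  case: pselect => [Vp|nVp] //.
- by have [_ ->] := Vlf Vp pq.
- by case: nVp; have [] := Vlf Vq (leaf_sym pq).
- by case: nVq; have [] := Vlf Vp pq.
Qed.

Lemma bump_ge0 j p : 0 <= bump j p.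
Proof. by rewrite /bump; case: pselect => // Vp; exact: pospow_ge0. Qed.

Lemma bump_le1 j p : bump j p <= 1.
Proof.
rewrite /bump; case: pselect => // Vp; rewrite /pospow exprn_ile1 //.
  by rewrite le_max lexx.
by rewrite ge_max ler01 lerBlDr lerDl sqr_ge0.
Qed.

Lemma bump_core j p : V j p -> `|g j p| < e j / 2 -> 0 < bump j p.
Proof.
move=> Vp; rewrite ltr_norml => /andP[h1 h2]; rewrite bumpE // pospow_gt0.
have ej := e0 j.
have h : (2 / e j * g j p) ^+ 2 = (g j p) ^+ 2 / (e j / 2) ^+ 2.
  by field; rewrite gt_eqF.
by rewrite h subr_gt0 ltr_pdivrMr ?exprn_gt0 ?divr_gt0 // mul1r; nra.
Qed.

Lemma bump_out j p : ~ (V j p /\ `|g j p| <= e j / 2) -> bump j p = 0.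
Proof.
move=> n; rewrite /bump; case: pselect => // Vp; apply: pospow_le0.
have ej := e0 j.
have h : (2 / e j * g j p) ^+ 2 = `|g j p| ^+ 2 / (e j / 2) ^+ 2.
  by rewrite real_normK ?num_real //; field; rewrite gt_eqF.
have lt : e j / 2 < `|g j p| by rewrite ltNge; apply/negP => h'; exact: n.
by rewrite h subr_le0 ler_pdivlMr ?exprn_gt0 ?divr_gt0 // mul1r; nra.
Qed.

Lemma near_out i j t : `|t| < e i -> ~ V j (s i t) ->
  \forall z \near t, ~ (V j (s i z) /\ `|g j (s i z)| <= e j / 2).
Proof.
move=> te nV; have e2 : e j / 2 < e j by have := e0 j; lra.
have nQ : \forall p \near s i t, (~` [set p | V j p /\ `|g j p| <= e j / 2]) p.
  apply: open_nbhs_nbhs; split; first exact/closed_openC/core_closed.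
  by move=> [].
have h : \forall z \near t, (~` [set p | V j p /\ `|g j p| <= e j / 2]) (s i z).
  exact: (sc te) nQ.
exact: h.
Qed.

Lemma smooth_bump i j t : `|t| < e i -> smooth_at k (bump j \o s i) t.
Proof.
move=> te; have [Vj|nV] := pselect (V j (s i t)); last first.
  apply: smooth_at_eq (smooth_at_cst k 0 t).
  by apply: filterS (near_out te nV) => z /= /bump_out ->.
have [sm _] := local_diffeo_transition te Vj.
have {sm} sm := smooth_at_le (leqnSn k) sm.
have s1 := smooth_at_mul (smooth_at_cst k (2 / e j) t) sm.
have s2 := smooth_at_mul (smooth_at_cst k (-1) t) (smooth_at_mul s1 s1).
have := smooth_at_pospow (smooth_at_add (smooth_at_cst k 1 t) s2).
apply: smooth_at_eq; apply: filterS (near_V te Vj) => z /= Vz.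
by rewrite bumpE // mulN1r expr2.
Qed.

(* Where some earlier bump is at least [d] and [j * d >= 1], the weight [j]
   vanishes: this makes the family of weights locally finite. *)
Definition weight j p : R :=
  pospow k (bump j p + - j%:R * \sum_(i < j) bump i p).

Lemma weight_lf j p q : lf p q -> weight j q = weight j p.
Proof.
move=> pq; rewrite /weight (bump_lf _ pq); congr (pospow k (_ + _ * _)).
by apply: eq_bigr => i _; exact: bump_lf.
Qed.

Lemma sum_bump_ge0 j p : 0 <= \sum_(i < j) bump i p.
Proof. by apply: sumr_ge0 => i _; exact: bump_ge0. Qed.

Lemma weight_out j p : bump j p = 0 -> weight j p = 0.
Proof.
move=> b0; rewrite /weight b0 add0r; apply: pospow_le0.
by rewrite mulNr oppr_le0 mulr_ge0 // sum_bump_ge0.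
Qed.

Lemma weight_V j p : weight j p != 0 -> V j p.
Proof.
apply: contra_neqP => nV; apply: weight_out; apply: bump_out; by case.
Qed.

Lemma smooth_weight i j t : `|t| < e i -> smooth_at k (weight j \o s i) t.
Proof.
move=> te; have s1 : smooth_at k (fun x => \sum_(l < j) bump l (s i x)) t.
  apply: (@smooth_at_sum _ k j (fun l x => bump l (s i x))) => l _.
  exact: smooth_bump.
have s2 := smooth_at_mul (smooth_at_cst k (- j%:R) t) s1.
exact: (smooth_at_pospow (smooth_at_add (smooth_bump j te) s2)).
Qed.

(** At the least index whose bump is positive, the subtracted sum of earlier bumps is zero. *)
Lemma weight_gt0 p : exists j, 0 < weight j p.
Proof.
have ex : exists n, 0 < bump n p.
  by have [n [Vn gn]] := core_cover p; exists n; exact: bump_core.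
pose n := ex_minn ex; exists n; rewrite /n; case: ex_minnP => {n} n bn nmin.
rewrite /weight big1 ?mulr0 ?addr0 ?pospow_gt0 // => i _.
apply/eqP; rewrite eq_le bump_ge0 andbT leNgt; apply/negP => /nmin.
by rewrite leqNgt ltn_ord.
Qed.

Definition vanishes p N : Prop := forall j, (N <= j)%N -> weight j p = 0.

Lemma weight_locally_finite i t : `|t| < e i ->
  exists N, \forall z \near t, vanishes (s i z) N.
Proof.
move=> te; have [l [Vl gl]] := core_cover (s i t).
set d := bump l (s i t); have d0 : 0 < d by exact: bump_core.
have /smooth_at_continuous c := smooth_bump l te.
have n1 : \forall z \near t, d / 2 < bump l (s i z).
  apply: (c [set w | d / 2 < w]); apply: open_nbhs_nbhs; split;
    first exact: open_gt.
  by rewrite /= -/d; lra.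
(* The bound j > l makes [bump l], which exceeds d / 2 near [t], occur among the earlier bumps; j >=
   2 / d makes j times that value at least 1, the maximum of [bump j]. *)
exists (maxn l.+1 (Num.trunc (2 / d)).+1).
apply: filterS n1 => z dz j; rewrite geq_max => /andP[lj dj].
apply: pospow_le0; rewrite mulNr subr_le0.
apply: (le_trans (bump_le1 _ _)).
have h1 : d / 2 <= \sum_(i0 < j) bump i0 (s i z).
  rewrite (bigD1 (Ordinal lj)) //= -[X in X <= _]addr0 lerD ?(ltW dz) //.
  by apply: sumr_ge0 => *; exact: bump_ge0.
have h2 : 2 / d <= j%:R.
  apply: ltW; apply: (lt_le_trans (Num.Theory.truncnS_gt _)).
  by rewrite ler_nat.
apply: (@le_trans _ _ ((2 / d) * (d / 2))).
  by rewrite le_eqVlt; apply/orP; left; apply/eqP; field; rewrite gt_eqF.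
by apply: ler_pM => //; apply: divr_ge0 => //; exact: ltW.
Qed.

Lemma vanishes_lf p q N : lf p q -> vanishes p N -> vanishes q N.
Proof. by move=> pq vp j /vp; rewrite (weight_lf _ pq). Qed.

Lemma vanishes_exists p : exists N, vanishes p N.
Proof.
have [i [Vi gi']] := core_cover p.
have [N nN] := weight_locally_finite (box_lt (bx i) Vi).
exists N; exact: vanishes_lf (leaf_sym (sg Vi)) (nbhs_singleton nN).
Qed.

(* The density is the sum of the [weight j * |d (g j)|], written in the
   coordinate [g i]; it needs no orientation of the leaf space. *)
Definition density_term i j t : R :=
  weight j (s i t) * `|((g j \o s i)^`())%classic t|.

Definition density i t : R :=
  \sum_(j < sval (cid (vanishes_exists (s i t)))) density_term i j t.

(** Terms beyond a vanishing index are zero, so the cut-off chosen in [density] is immaterial and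
    can be taken locally constant. *)
Lemma densityE i t N : vanishes (s i t) N ->
  density i t = \sum_(j < N) density_term i j t.
Proof.
have key n n' : (n <= n')%N -> vanishes (s i t) n ->
    \sum_(j < n') density_term i j t = \sum_(j < n) density_term i j t.
  move=> nn' v; rewrite -!(big_mkord xpredT (fun j => density_term i j t)).
  rewrite (@big_cat_nat _ _ _ n) //=.
  have -> : \sum_(n <= j < n') density_term i j t = 0; last by rewrite addr0.
  rewrite big_nat_cond big1 // => j /andP[/andP[nj _] _].
  by rewrite /density_term v // mul0r.
rewrite /density; case: (cid _) => n vn /= vN.
by case: (leqP n N) => [nN|/ltnW nN];
  [rewrite (key _ _ nN vn)|rewrite (key _ _ nN vN)].
Qed.

Lemma smooth_density_term i j t : `|t| < e i ->
  smooth_at k (density_term i j) t.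
Proof.
move=> te; have [Vj|nV] := pselect (V j (s i t)); last first.
  apply: smooth_at_eq (smooth_at_cst k 0 t).
  apply: filterS (near_out te nV) => z /= /bump_out/weight_out w0.
  by rewrite /density_term w0 mul0r.
have [sm d0] := local_diffeo_transition te Vj.
exact: smooth_at_mul (smooth_weight j te) (smooth_at_norm d0 (smooth_at_derive1
  sm)).
Qed.

Lemma smooth_density i t : `|t| < e i -> smooth_at k (density i) t.
Proof.
move=> te; have [N nN] := weight_locally_finite te.
apply: smooth_at_eq (smooth_at_sum (n := N) (f := density_term i) _).
  by apply: filterS nN => z /densityE ->.
by move=> j _; exact: smooth_density_term.
Qed.

Lemma density_gt0 i t : `|t| < e i -> 0 < density i t.
Proof.
move=> te; have [j wj] := weight_gt0 (s i t).
have [N vN] := vanishes_exists (s i t).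
have jN : (j < N)%N.
  by rewrite ltnNge; apply/negP => /vN w0; rewrite w0 ltxx in wj.
rewrite (densityE vN) (bigD1 (Ordinal jN)) //= ltr_pwDl //.
  have [_ d0] := local_diffeo_transition te (weight_V (lt0r_neq0 wj)).
  by rewrite mulr_gt0 // normr_gt0.
by apply: sumr_ge0 => *; rewrite mulr_ge0 // pospow_ge0.
Qed.

(** Each term obeys the chain rule: near [t] the map [g l \o s i] factors through [g j \o s i] and
    [g l \o s j], because passing to the section [s j] stays on the same leaf. *)
Lemma density_change i j t : `|t| < e i -> V j (s i t) ->
  density i t = density j (g j (s i t)) * `|((g j \o s i)^`())%classic t|.
Proof.
move=> te Vj; have [N vN] := vanishes_exists (s i t).
have ss := sg Vj.
rewrite (densityE vN) (densityE (vanishes_lf ss vN)) mulr_suml.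
apply: eq_bigr => l _; rewrite /density_term (weight_lf _ ss) -mulrA.
have [->|w0] := eqVneq (weight l (s i t)) 0; first by rewrite !mul0r.
have Vl := weight_V w0; congr (_ * _); rewrite -normrM; congr (`|_|).
have gj := box_lt (bx j) Vj.
have Vl' : V l (s j (g j (s i t))) by have [] := Vlf Vl ss.
have [sm1 _] := local_diffeo_transition te Vj;
  have [sm2 _] := local_diffeo_transition gj Vl'.
rewrite -(derive1_comp (f :=
  g j \o s i) (smooth_at_derivable sm1) (smooth_at_derivable sm2)).
rewrite !derive1E; apply: near_eq_derive.
apply: filterS2 (near_V te Vj) (near_V te Vl) => z Vjz Vlz /=.
by have [_ ->] := Vlf Vlz (sg Vjz).
Qed.

(** * Arc length coordinates *)

Lemma coordinate_exists i : exists X : R -> R,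
  forall t, `|t| < e i / 2 -> deriv X t (density i t).
Proof.
(* A closed interval of continuity is wanted; half the width of the box leaves room for its ends. *)
apply: primitive_exists; first by rewrite divr_gt0.
move=> t te; apply: (@smooth_at_continuous _ k); apply: smooth_density.
by have := e0 i; lra.
Qed.

Definition coordinate i : R -> R := sval (cid (coordinate_exists i)).
Local Notation X := coordinate.

Lemma coordinateP i t : `|t| < e i / 2 -> deriv (X i) t (density i t).
Proof. exact: svalP (cid (coordinate_exists i)) t. Qed.

Let e2 i t : `|t| < e i / 2 -> `|t| < e i.
Proof. by move=> h; have := e0 i; lra. Qed.

Lemma coordinate_lt i y z : `|y| < e i / 2 -> `|z| < e i / 2 -> y < z ->
  X i y < X i z.
Proof.
move=> ye ze yz.
have [|||c ce E] := @mean_value R (X i) (density i) 0 (e i / 2) y z _ _ _ (ltW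
  yz).
- by move=> w; rewrite subr0; exact: coordinateP.
- by rewrite subr0.
- by rewrite subr0.
rewrite subr0 in ce; rewrite -subr_gt0 E mulr_gt0 ?subr_gt0 //.
exact: density_gt0 (e2 ce).
Qed.

Lemma coordinate_inj i y z : `|y| < e i / 2 -> `|z| < e i / 2 ->
  X i y = X i z -> y = z.
Proof.
move=> ye ze E; case: (ltgtP y z) => // h.
  by have := coordinate_lt ye ze h; rewrite E ltxx.
by have := coordinate_lt ze ye h; rewrite E ltxx.
Qed.

Lemma coordinate_lt_inv i y z : `|y| < e i / 2 -> `|z| < e i / 2 ->
  X i y < X i z -> y < z.
Proof.
move=> ye ze E; rewrite ltNge; apply/negP; rewrite le_eqVlt => /orP[/eqP h|h].
  by rewrite h ltxx in E.
by have := coordinate_lt ze ye h; lra.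
Qed.

Lemma coordinate_cont i t : `|t| < e i / 2 -> {for t, continuous (X i)}.
Proof.
move=> te; apply: differentiable_continuous; apply/derivable1_diffP.
by have [] := coordinateP te.
Qed.

(** Continuity of the inverse of [X i]: strict monotonicity traps the parameter between t - d / 2
    and t + d / 2. *)
Lemma near_coordinate i t (B : R -> Prop) : `|t| < e i / 2 ->
  (\forall z \near t, B z) ->
  \forall y \near X i t, forall z, `|z| < e i / 2 -> X i z = y -> B z.
Proof.
move=> te nB; have [d /= d0 dB] :=
  (nbhs_ballP _ _).1 (filterI nB (near_lt0 te)).
have tb z : `|z - t| < d -> B z /\ `|z| < e i / 2.
  by move=> h; apply: dB; rewrite /ball /= distrC.
have [_ h1] : B (t - d / 2) /\ `|t - d / 2| < e i / 2.
  by apply: tb; rewrite addrAC subrr add0r normrN gtr0_norm; lra.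
have [_ h2] : B (t + d / 2) /\ `|t + d / 2| < e i / 2.
  by apply: tb; rewrite addrAC subrr add0r gtr0_norm; lra.
have l1 : X i (t - d / 2) < X i t by apply: coordinate_lt => //; lra.
have l2 : X i t < X i (t + d / 2) by apply: coordinate_lt => //; lra.
have n1 : \forall y \near X i t, X i (t - d / 2) < y by exact: lt_nbhsr.
have n2 : \forall y \near X i t, y < X i (t + d / 2) by exact: lt_nbhsl.
apply: filterS2 n1 n2 => y y1 y2 z ze zy; rewrite -zy in y1 y2.
have z1 := coordinate_lt_inv h1 ze y1; have z2 := coordinate_lt_inv ze h2 y2.
by have [] := tb z; first by rewrite ltr_norml; apply/andP; split; lra.
Qed.

Lemma coordinate_image i :
  open (X i @` [set t | `|t| < e i / 2]) /\
    is_interval (X i @` [set t | `|t| < e i / 2]).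
Proof.
have iX : is_interval (X i @` [set t | `|t| < e i / 2]).
  move=> _ _ [a ae <-] [b be <-] c /andP[ac cb].
  have ab : a <= b.
    rewrite leNgt; apply/negP => ba; have := coordinate_lt be ae ba; lra.
  have in_ab z : a <= z -> z <= b -> `|z| < e i / 2.
    move=> az zb; move: ae be;
      rewrite /= !ltr_norml => /andP[a1 a2] /andP[b1 b2].
    by apply/andP; split; lra.
  have [|| z] := @IVT R (X i) a b c ab.
  - apply: continuous_in_subspaceT => w;
      rewrite inE /= in_itv /= => /andP[aw wb].
    exact: coordinate_cont (in_ab _ aw wb).
  - by rewrite ge_min le_max ac cb orbT.
  - by rewrite in_itv /= => /andP[az zb] <-; exists z => //; exact: in_ab.
split=> //; rewrite openE => _ [t /= te <-]; rewrite /interior.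
have [d /= d0 dB] := (nbhs_ballP _ _).1 (near_lt0 te).
have h1 : `|t - d / 2| < e i / 2.
  by apply: dB; rewrite /ball /= opprB addrCA subrr addr0 gtr0_norm; lra.
have h2 : `|t + d / 2| < e i / 2.
  by apply: dB; rewrite /ball /= opprD addrA subrr sub0r normrN gtr0_norm; lra.
have n1 : \forall y \near X i t, X i (t - d / 2) < y.
  by apply: lt_nbhsr; apply: coordinate_lt => //; lra.
have n2 : \forall y \near X i t, y < X i (t + d / 2).
  by apply: lt_nbhsl; apply: coordinate_lt => //; lra.
apply: filterS2 n1 n2 => y y1 y2.
apply: (iX (X i (t - d / 2)) (X i (t + d / 2)));
  [by exists (t - d / 2)|by exists (t + d / 2)|].
by rewrite !ltW.
Qed.

(** * Flat charts of the leaf space *)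

Definition core i : set M := [set p | V i p /\ `|g i p| < e i / 2].
(** The arc length coordinate of the leaf of [p]; the pairs [core i], [flow i] are the charts fed to
    the geodesic argument. *)
Definition flow i p : R := X i (g i p).

Lemma near_core i p : core i p -> \forall q \near p, core i q.
Proof.
move=> [Vp gp]; have n1 : \forall q \near p, V i q.
  by apply: open_nbhs_nbhs; split=> //; exact: (box_open (bx i)).
have n2 : \forall q \near p, `|g i q| < e i / 2 by exact: (gc Vp) (near_lt0 gp).
by apply: filterS2 n1 n2.
Qed.

Lemma core_open i : open (core i).
Proof. by rewrite openE => p /near_core. Qed.

Lemma core_lf i p q : core i p -> lf p q -> core i q /\ flow i q = flow i p.
Proof.
by move=> [Vp gp] pq; have [Vq gq] := Vlf Vp pq; rewrite /core /flow /= gq.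
Qed.

Lemma flow_inj i p q : core i p -> core i q -> flow i p = flow i q -> lf p q.
Proof.
move=> [Vp gp] [Vq gq] /(coordinate_inj gp gq) E.
by apply: leaf_trans (sg Vp) _; rewrite E; exact: leaf_sym (sg Vq).
Qed.

Lemma flow_cont i p : core i p -> {for p, continuous (flow i)}.
Proof. by move=> [Vp gp];
  exact: (continuous_comp (gc Vp) (coordinate_cont gp)). Qed.

(** The saturated predicate spreads along the leaf to the point of the section [s i]; continuity of
    [s i] and of the inverse of [X i] do the rest. *)
Lemma flow_section i p (P : M -> Prop) : core i p -> saturated lf P ->
  (\forall q \near p, P q) ->
  \forall y \near flow i p, forall q, core i q -> flow i q = y -> P q.
Proof.
move=> [Vp gp] sP nP.
have n1 : \forall q \near s i (g i p), P q.
  apply: filterS (saturation_nbhs (sg Vp) nP) => q [z Pz zq]; exact: sP zq Pz.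
have n2 : \forall t \near g i p, P (s i t) by exact: (sc (e2 gp)) n1.
apply: filterS (near_coordinate gp n2) => y h q [Vq gq] E.
exact: sP (leaf_sym (sg Vq)) (h _ gq E).
Qed.

Lemma flow_image i : open (flow i @` core i) /\ is_interval (flow i @` core i).
Proof.
have -> : flow i @` core i = X i @` [set t | `|t| < e i / 2].
  rewrite eqEsubset; split=> [_ [p [Vp gp] <-]|_ [t te <-]];
    first by exists (g i p).
  exists (s i t); last by rewrite /flow gs //; exact: e2.
  by split; [exact: Vs (e2 te)|rewrite gs //; exact: e2].
exact: coordinate_image.
Qed.

(** By [density_change] the derivatives of [X j \o tau] and of [X i] differ by the sign of the
    derivative of the transition [tau], which is constant near [t]. With that sign as [c], the
    function [D] has zero derivative. *)
Lemma flow_change i j p : core i p -> core j p -> exists c d : R,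
  (c = 1 \/ c = -1) /\ \forall q \near p, flow j q = c * flow i q + d.
Proof.
move=> Cip [Vj gj]; have [Vi gi'] := Cip; set t := g i p in gi'.
have tE := e2 gi'; have [Vj' gE] := Vlf Vj (sg Vi).
pose tau := g j \o s i; have lt : local_diffeo k tau t by exact:
  local_diffeo_transition.
have [sm d0] := lt; have cd := smooth_at_continuous (smooth_at_derive1 sm).
have [c [sc1 nc]] : exists c : R, (c = 1 \/ c = -1) /\
    \forall z \near t, `|(tau^`())%classic z| = c * (tau^`())%classic z.
  case: (ltgtP (tau^`()%classic t) 0) d0 => // h _.
    exists (-1); split; first by right.
    have : \forall z \near t, (tau^`())%classic z < 0.
      by apply: (cd [set w | w < 0]); apply: open_nbhs_nbhs; split=> //;
        exact: open_lt.
    by apply: filterS => z zn; rewrite ltr0_norm // mulN1r.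
  exists 1; split; first by left.
  have : \forall z \near t, 0 < (tau^`())%classic z.
    by apply: (cd [set w | 0 < w]); apply: open_nbhs_nbhs; split=> //;
      exact: open_gt.
  by apply: filterS => z zn; rewrite gtr0_norm // mul1r.
have cc : c * c = 1 by case: sc1 => ->; rewrite ?mulrNN mulr1.
have tj : `|tau t| < e j / 2 by rewrite /tau /= gE.
have n1 : \forall z \near t, `|tau z| < e j / 2.
  exact: (local_diffeo_continuous lt) (near_lt0 tj).
pose D z := X j (tau z) - c * X i z.
have dD : \forall z \near t, deriv D z 0.
  apply: filterS3 (filterI nc n1) (filterI (near_lt0 gi') (near_V tE Vj'))
    (local_diffeo_near lt).
  move=> z [cz tz] [iz Vjz] [smz _].
  have D1 := coordinateP tz; have D2 := coordinateP iz.
  have D3 : deriv tau z (tau^`()%classic z).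
    by apply: DeriveDef; [exact: smooth_at_derivable smz|rewrite derive1E].
  have D4 : deriv (X j \o tau) z (density j (tau z) * tau^`()%classic z).
    have [dX XE] := D1; have [dt tE'] := D3.
    apply: DeriveDef.
      by apply/derivable1_diffP; apply: differentiable_comp;
        apply/derivable1_diffP.
    by rewrite -derive1E derive1_comp // derive1E XE.
  have D5 : deriv (fun z => c * X i z) z (c * density i z) by exact: is_deriveZ.
  apply: is_derive_eq (is_deriveB D4 D5) _.
  rewrite (density_change (e2 iz) Vjz) -/tau cz /tau /=.
  rewrite [X in _ - X](_ : _ = (c * c) * (density j (g j (s i z)) *
    ((g j \o s i)^`())%classic z)); last by ring.
  by rewrite cc mul1r subrr.
have [d /= dp dB] := (nbhs_ballP _ _).1 dD.
have DE z : `|z - t| < d -> D z = D t.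
  move=> zt; have dF w : `|w - t| < d -> deriv D w (cst (0 : R) w).
    by move=> h; apply: dB; rewrite /ball /= distrC.
  have tt : `|t - t| < d by rewrite subrr normr0.
  case: (leP z t) => [h|/ltW h].
    have [w _] := mean_value dF zt tt h; rewrite mul0r => /eqP.
    by rewrite subr_eq0 => /eqP.
  have [w _] := mean_value dF tt zt h; rewrite mul0r => /eqP.
  by rewrite subr_eq0 => /eqP.
exists c, (D t); split=> //.
have n2 : \forall q \near p, `|g i q - t| < d.
  have nw : \forall w \near t, `|w - t| < d by apply: near_lt;
    rewrite subrr normr0.
  exact: (gc Vi) nw.
have n3 : \forall q \near p, V j (s i (g i q)) by exact: (gc Vi) (near_V tE
  Vj').
apply: filterS3 n2 n3 (near_core Cip) => q qd Vjq [Viq _].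
have := DE _ qd; rewrite /D /flow /tau /= => <-.
have [_ <-] := Vlf Vjq (leaf_sym (sg Viq)); ring.
Qed.

(** Take a core containing [p]. If [q] is in the same box, values of [g i] separate the leaves;
    otherwise the core and the complement of the closed core do. *)
Lemma leaf_hausdorff p q : ~ lf p q -> exists B C : M -> Prop,
  [/\ saturated lf B, saturated lf C, (\forall z \near p, B z),
      (\forall z \near q, C z) & forall z, B z -> C z -> False].
Proof.
move=> npq; have [i Cp] := core_cover p; have [Vp gp] := Cp.
have [Vq|nVq] := pselect (V i q).
  have gpq : g i p != g i q.
    apply/eqP => E; apply: npq; apply: leaf_trans (sg Vp) _.
    by rewrite E; exact: leaf_sym (sg Vq).
  have d0 : 0 < `|g i p - g i q| by rewrite normr_gt0 subr_eq0.
  pose B p (z : M) := V i z /\ `|g i z - g i p| < `|g i p - g i q| / 2.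
  pose C (z : M) := V i z /\ `|g i z - g i q| < `|g i p - g i q| / 2.
  have nV r : V i r -> \forall z \near r, V i z.
    by move=> Vr; apply: open_nbhs_nbhs; split=> //; exact: (box_open (bx i)).
  exists (B p), C; split.
  - by move=> z w zw [Vz gz]; have [Vw gw] := Vlf Vz zw; split=> //; rewrite gw.
  - by move=> z w zw [Vz gz]; have [Vw gw] := Vlf Vz zw; split=> //; rewrite gw.
  - have n1 : \forall z \near p, `|g i z - g i p| < `|g i p - g i q| / 2.
      have nw : \forall w \near g i p, `|w - g i p| < `|g i p - g i q| / 2.
        by apply: near_lt; rewrite subrr normr0 divr_gt0.
      exact: (gc Vp) nw.
    by apply: filterS2 (nV _ Vp) n1.
  - have n1 : \forall z \near q, `|g i z - g i q| < `|g i p - g i q| / 2.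
      have nw : \forall w \near g i q, `|w - g i q| < `|g i p - g i q| / 2.
        by apply: near_lt; rewrite subrr normr0 divr_gt0.
      exact: (gc Vq) nw.
    by apply: filterS2 (nV _ Vq) n1.
  - move=> z [_ z1] [_ z2].
    have := ler_distD (g i z) (g i p) (g i q); rewrite (distrC (g i p) (g i z));
      lra.
have e2i : e i / 2 < e i by have := e0 i; lra.
exists (core i), (fun z => ~ (V i z /\ `|g i z| <= e i / 2)); split.
- by move=> z w zw Cz; have [] := core_lf Cz zw.
- move=> z w zw nz [Vw gw]; apply: nz; have [Vz gz] := Vlf Vw (leaf_sym zw).
  by split=> //; rewrite gz.
- exact: near_core.
- apply: open_nbhs_nbhs; split; first exact: closed_openC (core_closed e2i).
  by case.
- by move=> z [Vz gz]; apply; split=> //; exact: ltW.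
Qed.

Lemma flow_compact i p : core i p -> exists2 d : R, 0 < d &
  compact [set q | core i q /\ `|flow i q - flow i p| <= d].
Proof.
(* The level [a] lies strictly between [|g i p|] and the edge e / 2 of the core; [d] is then chosen
   so that staying within [d] in arc length forces [|g i| <= a], a compact set. *)
move=> Cp; have [Vp gp] := Cp; pose a := (`|g i p| + e i / 2) / 2.
have a1 : `|g i p| < a by rewrite /a; lra.
have a2 : a < e i / 2 by rewrite /a; lra.
have a0 : 0 <= a by apply: ltW; apply: le_lt_trans a1.
have ha : `|a| < e i / 2 by rewrite ger0_norm.
have hna : `| - a| < e i / 2 by rewrite normrN.
have [l1 l2] : - a < g i p /\ g i p < a by move: a1; rewrite ltr_norml => /andP.
have x1 := coordinate_lt hna gp l1; have x2 := coordinate_lt gp ha l2.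
pose d := Num.min (X i (g i p) - X i (- a)) (X i a - X i (g i p)) / 2.
have d0 : 0 < d by rewrite divr_gt0 // lt_min !subr_gt0 x1 x2.
have [da db] : d < X i (g i p) - X i (- a) /\ d < X i a - X i (g i p).
  have m1 : Num.min (X i (g i p) - X i (- a)) (X i a - X i (g i p)) <= X i (g i
    p) - X i (- a).
    by rewrite ge_min lexx.
  have m2 : Num.min (X i (g i p) - X i (- a)) (X i a - X i (g i p)) <= X i a - X
    i (g i p).
    by rewrite ge_min lexx orbT.
  by rewrite /d in d0 *; split; lra.
exists d => //.
have ae : a < e i by have := e0 i; lra.
have sub : [set q | core i q /\ `|flow i q - flow i p| <= d] `<=`
    [set q | V i q /\ `|g i q| <= a].
  move=> q [[Vq gq]]; rewrite /flow ler_norml => /andP[h1 h2]; split=> //.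
  rewrite ler_norml; apply/andP; split; rewrite ltW //.
    by apply: (coordinate_lt_inv hna gq); lra.
  by apply: (coordinate_lt_inv gq ha); lra.
apply: (subclosed_compact _ (box_compact (bx i) ae) sub).
rewrite -openC openE => q nq; rewrite /interior.
have [[Vq gq]|nQ] := pselect (V i q /\ `|g i q| <= a); last first.
  have : \forall z \near q, ~ (V i z /\ `|g i z| <= a).
    apply: open_nbhs_nbhs; split=> //; exact: closed_openC (core_closed ae).
  by apply: filterS => z nz /sub.
have Cq : core i q by split=> //; exact: le_lt_trans a2.
have lt : d < `|flow i q - flow i p|.
  by rewrite ltNge; apply/negP => h; apply: nq.
have c : {for q, continuous (fun z => `|flow i z - flow i p|)}.
  apply: (@continuous_comp _ _ _ (fun z => flow i z - flow i p));
    last exact: norm_continuous.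
  by apply: cvgB; [exact: flow_cont|exact: cvg_cst].
have : \forall z \near q, d < `|flow i z - flow i p|.
  apply: (c [set w | d < w]); apply: open_nbhs_nbhs; split=> //; exact: open_gt.
by apply: filterS => z dz [_]; rewrite leNgt dz.
Qed.

Hypotheses (cM : connected [set: M]) (ncM : ~ compact [set: M]).

(** Locally [f] is [u \o g i] with [u] a signed, shifted primitive of the density: of class C^(k+1)
    because the density is C^k, with nonzero derivative because it is positive. *)
Lemma global_first_integral : exists f : M ->
  R, forall p, first_integral_at f p.
Proof.
have [p0 _] : exists p0 : M, True.
  apply: contrapT => np; apply: ncM; have -> : [set: M] = set0;
    last exact: compact0.
  by rewrite eqEsubset; split=> // p _; case: np; exists p.
have [f fP] := @global_coordinate R M nat lf core flow (@leaf_refl _ _ _ F)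
  (@leaf_sym _ _ _ F) (@leaf_trans _ _ _ F) core_open core_cover core_lf
    flow_inj
  flow_cont flow_section flow_image flow_change leaf_hausdorff flow_compact cM
    ncM p0.
exists f => p; have [i [c [d [sc1 [Vp gp] nf]]]] := fP p.
have c0 : c != 0 by case: sc1 => ->; rewrite ?oppr_eq0 oner_neq0.
pose u z := c * (X i z + - d).
have lu : local_diffeo k u (g i p).
  have D1 := coordinateP gp.
  split.
    have sX : smooth_at k.+1 (X i) (g i p).
      apply: smooth_at_primitive (smooth_density (e2 gp)).
      by apply: filterS (near_lt0 gp) => z; exact: coordinateP.
    exact: smooth_at_mul (smooth_at_cst _ c _) (smooth_at_add sX (smooth_at_cst
      _ (- d) _)).
  have D2 : deriv u (g i p) (c * (density i (g i p) + 0)).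
    by apply: is_deriveZ; apply: is_deriveD.
  rewrite derive1E; have [_ ->] := D2.
  by rewrite addr0 mulf_neq0 // gt_eqF // density_gt0 // e2.
apply: first_integral_eq (first_integral_comp (gi Vp) lu).
by apply: filterS nf => q ->.
Qed.

End Density.

(** * The global first integral *)

Section FirstIntegral.
Context {R : realType} {m : nat} {M : topologicalType}.
Variables (k : nat) (A F : set (chart R m.+1 M)).
Hypotheses (atlasA : Cr_atlas k.+1 A) (folF : Cr_foliation k.+1 A F).
Implicit Types (phi psi : chart R m.+1 M) (p q : M).
Variable f : M -> R.
Hypothesis fiP : forall p, first_integral_at k F f p.

Lemma first_integral_Cr : Cr_function k.+1 A f.
Proof.
move=> al Aal; apply: Ck_local => _ [p dp <-].
have [phi Fphi dphi] := fol_chart folF p.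
have [h [[U [oU Uy ch]] _] fh] := fiP Fphi dphi.
pose D := (cdom phi `&` [set q | f q = h (tcoord phi q)]°) `&` (tcoord phi @^-1`
  U)°.
have oD : open D.
  apply: openI; last exact: open_interior.
  by apply: openI; [exact: cdom_open|exact: open_interior].
have Dp : D p.
  split; first by split.
  have nU : \forall y \near tcoord phi p, U y by apply: open_nbhs_nbhs.
  exact: (tcoord_cont dphi) nU.
have oW := open_cmap_image (phi := al) oD.
exists (cmap al @` (cdom al `&` D)); split=> //; first by exists p.
have cW : Ck k.+1 (cmap al @` (cdom al `&` D)) (tcoord phi \o cinv al : _ ->
  R^o).
  apply: Ck_sub (Ck_tcoord folF Fphi Aal) => _ [q [dq [[dq' _] _]] <-].
  by exists q.
apply: (Ck_eq (f := (h : R^o -> R^o) \o (tcoord phi \o cinv al : _ -> R^o)) oW).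
  move=> _ [q [dq [[_ /interior_subset fq] _]] <-] /=.
  by rewrite cmapK // fq.
apply: (Ck_comp_real oW _ cW ch) => _ [q [dq [_ /interior_subset Uq]] <-] /=.
by rewrite cmapK.
Qed.

Lemma change_differentiable phi psi p : F phi -> A psi -> cdom phi p ->
  cdom psi p ->
  differentiable (cmap phi \o cinv psi) (cmap psi p) /\
  differentiable (cmap psi \o cinv phi) (cmap phi p).
Proof.
move=> Fphi Apsi dp dq; have [_ _ /(_ _ _ Fphi Apsi)[[d1 _] [d2 _]] _] := folF.
by split; [apply: d2|apply: d1]; exists p.
Qed.

(** By the chain rule df is the derivative of the transverse germ times the differential of the
    transverse coordinate. The kernel statement and the regularity of [f] both follow. *)
Lemma first_integral_differential phi psi p : F phi -> A psi -> cdom phi p ->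
  cdom psi p -> exists2 a : R, a != 0 & forall v, differential f psi p v =
    a * ('d (cmap phi \o cinv psi) (cmap psi p) v : 'rV[R]_m.+1) ord0 ord_max.
Proof.
move=> Fphi Apsi dp dq; have [d1 _] := change_differentiable Fphi Apsi dp dq.
have [h [sh h0] fh] := fiP Fphi dp.
pose co (N : 'rV[R]_m.+1) : R^o := N ord0 ord_max.
have dco x : differentiable co x by exact: differentiable_coord.
have dt : differentiable (co \o (cmap phi \o cinv psi)) (cmap psi p).
  exact: differentiable_comp.
have tp : (co \o (cmap phi \o cinv psi)) (cmap psi p) = tcoord phi p.
  by rewrite /= cmapK.
exists ((h^`())%classic (tcoord phi p)) => // v.
have nE : {near cmap psi p, ((h : R^o ->
  R^o) \o (co \o (cmap phi \o cinv psi))) =1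
    (f \o cinv psi : _ -> R^o)}.
  have n1 : \forall x \near cmap psi p, f (cinv psi x) = h (tcoord phi (cinv psi
    x)).
    exact: (near_cinv (P := fun q => f q = h (tcoord phi q)) dq fh).
  by apply: filterS n1 => x /= ->.
have dh : derivable h ((co \o (cmap phi \o cinv psi)) (cmap psi p)) 1.
  by rewrite tp; exact: smooth_at_derivable sh.
have dhc : differentiable ((h : R^o ->
  R^o) \o (co \o (cmap phi \o cinv psi))) (cmap psi p).
  by apply: differentiable_comp => //; apply/derivable1_diffP.
have [_ E] := near_eq_diff nE dhc.
rewrite /differential E (derive1_diff _ dt dh) tp; congr (_ * _).
by rewrite -(deriveE v dt) -(deriveE v d1) (derive_mx (diff_derivable d1)) mxE.
Qed.

Lemma first_integral_foliation : foliation_induced_by A F f.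
Proof.
move=> L p psi _ _ Apsi dq; rewrite eqEsubset; split=> v /=.
  move=> [phi [Fphi dp] v0].
  by have [a _ ->] := first_integral_differential Fphi Apsi dp dq;
    rewrite v0 mulr0.
have [phi Fphi dp] := fol_chart folF p.
have [a a0 ->] := first_integral_differential Fphi Apsi dp dq.
by move/eqP; rewrite mulf_eq0 (negbTE a0) /= => /eqP v0; exists phi.
Qed.

Lemma first_integral_regular p psi : A psi -> cdom psi p ->
  differential f psi p <> cst 0.
Proof.
move=> Apsi dq f0; have [phi Fphi dp] := fol_chart folF p.
have [a a0 fE] := first_integral_differential Fphi Apsi dp dq.
have [d1 d2] := change_differentiable Fphi Apsi dp dq.
(* The transverse unit vector of the foliated chart, carried to the chart [psi]: its transverse
   component is 1, so df does not vanish on it. *)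
pose v := 'd (cmap psi \o cinv phi) (cmap phi p) (tdir : 'rV[R]_m.+1).
have e1 : (cmap psi \o cinv phi) (cmap phi p) = cmap psi p by rewrite /= cmapK.
have d1' : differentiable (cmap phi \o cinv psi) ((cmap psi \o cinv phi) (cmap
  phi p)).
  by rewrite e1.
have vE : 'd (cmap phi \o cinv psi) (cmap psi p) v = tdir.
  have nE : {near cmap phi p, (cmap phi \o cinv psi) \o (cmap psi \o cinv phi)
    =1 id}.
    have n1 := near_cinv (P := cdom psi) dp (cdom_nbhs dq).
    by apply: filterS2 n1 (cimg_nbhs (cimg_cmap dp)) => x dx cx /=;
      rewrite cmapK // cinvK.
  have [_ E] := near_eq_diff nE (differentiable_comp d2 d1').
  rewrite /v; have := diff_comp d2 d1'; rewrite e1 => E'.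
  have -> : 'd (cmap phi \o cinv psi) (cmap psi p) ('d (cmap psi \o cinv phi)
    (cmap phi p) tdir)
    = ('d (cmap phi \o cinv psi) (cmap psi p) \o 'd (cmap psi \o cinv phi) (cmap
      phi p)) tdir by [].
  by rewrite -E' -E diff_val.
have := fE v; rewrite f0 vE /= /tdir mxE !eqxx mulr1 => /esym/eqP.
by rewrite (negbTE a0).
Qed.

End FirstIntegral.

(** Lindelof argument: for each set of a countable basis that fits in the core of some box, one such
    box is kept. Every point has a basis neighbourhood inside the core of a box centred at it. *)
Lemma countable_boxes {R : realType} {m : nat} {M : topologicalType} (k : nat)
    (A F : set (chart R m.+1 M)) : Cr_foliation k.+1 A F ->
  @second_countable M -> [set: M] !=set0 ->
  (forall p : M, exists V g s e, is_box k F V g s e /\ (V p /\ g p = 0)) ->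
  exists (V : nat -> set M) (g : nat -> M -> R) (s : nat -> R -> M) (e : nat ->
    R),
    (forall n, is_box k F (V n) (g n) (s n) (e n)) /\
    forall p, exists n, V n p /\ `|g n p| < e n / 2.
Proof.
move=> folF [B /countable_injP[code cinj] [Bo Bb]] [p0 _] bex.
pose data := (set M * (M -> R) * (R -> M) * R)%type.
pose isb (w : data) := is_box k F w.1.1.1 w.1.1.2 w.1.2 w.2.
pose cor (w : data) := [set p | w.1.1.1 p /\ `|w.1.1.2 p| < w.2 / 2].
have ch n : {w : data | isb w /\ forall U, B U -> code U = n ->
    (exists w', isb w' /\ U `<=` cor w') -> U `<=` cor w}.
  apply: cid.
  have [[U [w' [BU Un bw Uw]]]|no] := pselect (exists U w',
      [/\ B U, code U = n, isb w' & U `<=` cor w']).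
    exists w'; split=> // U' BU' U'n _.
    by have -> : U' = U by apply: cinj; rewrite ?inE // U'n Un.
  (* An index that codes no such basis set receives an arbitrary box around [p0]. *)
  have [V [g [s [e [bw _]]]]] := bex p0; exists (V, g, s, e);
    split=> // U BU Un [w' [bw' Uw']].
  by case: no; exists U, w'.
pose w n := sval (ch n).
have wP n : isb (w n) /\ forall U, B U -> code U = n ->
  (exists w', isb w' /\ U `<=` cor w') ->
    U `<=` cor (w n) by exact: svalP (ch n).
exists (fun n => (w n).1.1.1), (fun n => (w n).1.1.2), (fun n =>
  (w n).1.2), (fun n => (w n).2).
split=> [n|p]; first by have [] := wP n.
have [V0 [g0 [s0 [e0 [bw [Vp gp]]]]]] := bex p.
have gt0 := box_gt0 bw.
have nc : nbhs p (cor (V0, g0, s0, e0)).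
  have n1 : \forall q \near p, V0 q by apply: open_nbhs_nbhs; split=> //;
    exact: box_open bw.
  have n2 : \forall q \near p, `|g0 q| < e0 / 2.
    have c := first_integral_cont folF (box_integral bw Vp).
    have nw : \forall z \near g0 p, `|z| < e0 / 2.
      by apply: near_lt0; rewrite gp normr0 divr_gt0.
    exact: c nw.
  by apply: filterS2 n1 n2.
have [U [BU Up] Uc] := Bb p _ nc.
exists (code U); have [_ h] := wP (code U).
by apply: h Up => //; exists (V0, g0, s0, e0).
Qed.

Theorem theorem6p7 (R : realType) (r m : nat) (M : topologicalType)
    (A F : set (chart R m.+1 M)) :
  (1 <= r)%N ->
  hausdorff_space M -> @second_countable M -> connected [set: M] ->
  Cr_atlas r A ->
  ~ compact [set: M] ->
  Cr_foliation r A F ->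
  (forall L : set M, is_leaf F L ->
     compact (L : set (leaf_space F)) /\ trivial_holonomy F L) ->
  exists f : M -> R,
    [/\ Cr_function r A f,
        foliation_induced_by A F f &
        forall x phi, A phi -> cdom phi x -> differential f phi x <> cst 0].
Proof.
case: r => // k _ hM scM cM atlasA ncM folF leaves.
have holF L : is_leaf F L -> trivial_holonomy F L by move=> /leaves[].
have cptF L : is_leaf F L ->
  compact (L : set (leaf_space F)) by move=> /leaves[].
(* The empty space is compact, so [M] has a point; [countable_boxes] needs one for its default
   box. *)
have M0 : [set: M] !=set0.
  apply: contrapT => M0; apply: ncM; rewrite (_ : setT = set0);
    first exact: compact0.
  by rewrite eqEsubset; split=> // p _; case: M0; exists p.
have [V [g [s [e [bx cov]]]]] :=
  countable_boxes folF scM M0 (box_exists hM atlasA folF holF cptF).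
have [f fP] := global_first_integral hM folF bx cov cM ncM.
exists f; split.
- exact: (first_integral_Cr folF fP).
- exact: (first_integral_foliation folF fP).
- move=> p phi Aphi dp; exact: (first_integral_regular folF fP Aphi dp).
Qed.
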